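(* Every cancellative atomic Markov category with conditionals satisfies all contraction identities.
   Context: Markov categories. A Markov category is a symmetric monoidal category $(\mathbf C,\otimes,I)$ in which every object $X$ carries a commutative comonoid $\Delta_X:X\to X\otimes X$, $\mathrm{del}_X:X\to I$, compatible with $\otimes$ (so $\Delta_{X\otimes Y}$ is $\Delta_X\otimes\Delta_Y$ followed by the middle swap, $\mathrm{del}_{X\otimes Y}=\mathrm{del}_X\otimes\mathrm{del}_Y$, and $\Delta_I,\mathrm{del}_I$ are trivial), and every $f:X\to Y$ satisfies $\mathrm{del}_Y\circ f=\mathrm{del}_X$. Naturality of $\Delta$ is not assumed. Coherence isomorphisms are suppressed. $\mathbf C$ has conditionals if for every $f:A\to X\otimes Y$ there is $f|_X:X\otimes A\to Y$ with $f=(\mathrm{id}_X\otimes f|_X)\circ(\Delta_X\otimes\mathrm{id}_A)\circ\big(((\mathrm{id}_X\otimes\mathrm{del}_Y)\circ f)\otimes\mathrm{id}_A\big)\circ\Delta_A$. For $p:A\to X$ and $f_1,f_2:W\otimes X\to Y$, write $f_1=_pf_2$ if $(f_1\otimes\mathrm{id}_X)\circ(\mathrm{id}_W\otimes(\Delta_X\circ p))=(f_2\otimes\mathrm{id}_X)\circ(\mathrm{id}_W\otimes(\Delta_X\circ p))$. For $p:A\to X$, $q:B\to X$ write $p\ll q$ if for all $W,Y$ and $f_1,f_2:W\otimes X\to Y$, $f_1=_qf_2$ implies $f_1=_pf_2$. $p:A\to X$ is atomic if $\Delta_X\circ p\ll p\otimes p$; $\mathbf C$ is atomic if all its morphisms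 are. An object $W$ is cancellable if $\mathrm{del}_W\otimes f_1=\mathrm{del}_W\otimes f_2$ implies $f_1=f_2$ for all parallel $f_1,f_2$; $\mathbf C$ is cancellative if all objects are cancellable. A morphism $f:X\otimes W'\to Y\otimes W$ is non-signalling (from $W'$ to $W$) if there is $f_s:X\to W$ with $(\mathrm{del}_Y\otimes\mathrm{id}_W)\circ f=f_s\otimes\mathrm{del}_{W'}$. Free Markov categories. A hypergraph $G$ has a set $W(G)$ of wires and sets $B_{m,n}(G)$ ($m,n\in\mathbb N$) of boxes, each box $b\in B_{m,n}(G)$ having a list of $m$ input wires and a list of $n$ output wires; homomorphisms are maps of wires and boxes preserving arities and input/output lists. It is finite if it has finitely many wires and boxes, and discrete if it has no boxes; $\underline m$ denotes the discrete hypergraph with $m$ wires. Let $\mathrm{in}(b,w)$ and $\mathrm{out}(b,w)$ be the number of times $w$ occurs among the inputs, resp. outputs, of $b$. A monoidal signature $\Sigma$ (types and typed generators) is regarded as a hypergraph with types as wires and generators as boxes. A Markov string diagram over $\Sigma$ is an isomorphism class of cospans $\underline m\xrightarrow{p}G\xleftarrow{q}\underline n$ of finite hypergraphs over $\Sigma$ (i.e. with compatible homomorphisms to $\Sigma$) such that: $G$ is acyclic (there is no sequence $w_1,b_1,\dots,w_k,b_k,w_{k+1}=w_1$, $k\ge1$, with $\mathrm{in}(b_i,w_i)>0$ and $\mathrm{out}(b_i,w_{i+1})>0$); left monogamy holds, i.e. $|p^{-1}(w)|+\sum_b\mathrm{out}(b,w)=1$ for each wire $w$; and there is no eliminable box,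 where $b$ is eliminable if every wire $w$ with $\mathrm{out}(b,w)>0$ satisfies $q^{-1}(w)=\emptyset$ and $\mathrm{in}(b',w)=0$ for all boxes $b'$. Normalization means repeatedly deleting eliminable boxes together with their output wires. $\mathbf{FreeMarkov}_\Sigma$ has as objects homomorphisms $\underline m\to\Sigma$ (lists of types; written $m$), as morphisms $m\to n$ the Markov string diagrams, composed by pushout followed by normalization; $\otimes$ is coproduct; copy and delete on a single wire are the cospans $\underline1\to\underline1\leftarrow\underline2$ and $\underline1\to\underline1\leftarrow\underline0$. It is the free Markov category over $\Sigma$. Contraction. For a non-signalling $f:m\otimes w\to n\otimes w$ in $\mathbf{FreeMarkov}_\Sigma$ given by $\underline m+\underline w\xrightarrow{[i,i']}G\xleftarrow{[j,j']}\underline n+\underline w$, let $G'$ be the pushout of $[i',j']:\underline w+\underline w\to G$ along $[\mathrm{id},\mathrm{id}]:\underline w+\underline w\to\underline w$; $\mathbf{contr}^w(f):m\to n$ is the normalization of the cospan $\underline m\to G\to G'\leftarrow G\leftarrow\underline n$ obtained from $i$ and $j$. Contraction identities. An interpreting functor $[\![-]\!]:\mathbf{FreeMarkov}_\Sigma\to\mathbf C$ is a Markov functor (strong symmetric monoidal, preserving copy and delete). A Markov category $\mathbf C$ satisfies all contraction identities if for every monoidal signature $\Sigma$, all non-signalling $C_1,C_2:m\otimes w\to n\otimes w$ in $\mathbf{FreeMarkov}_\Sigma$ and all interpreting functors $[\![-]\!]$, $[\![C_1]\!]=[\![C_2]\!]$ implies $[\![\mathbf{contr}^w(C_1)]\!]=[\![\mathbf{contr}^w(C_2)]\!]$.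 *)

(* Defs.v *)
From mathcomp Require Import all_boot.

Set Implicit Arguments.
Unset Strict Implicit.
Unset Printing Implicit Defensive.

(* Symmetric monoidal categories are not assumed to be strict, hence the      *)
(* coherence isomorphisms are explicit throughout.                            *)

Record category := Category {
  obj :> Type;
  hom : obj -> obj -> Type;
  idm : forall X, hom X X;
  comp : forall X Y Z, hom Y Z -> hom X Y -> hom X Z;
  comp1m : forall X Y (f : hom X Y), comp (idm Y) f = f;
  compm1 : forall X Y (f : hom X Y), comp f (idm X) = f;
  compA : forall X Y Z T (h : hom Z T) (g : hom Y Z) (f : hom X Y),
    comp h (comp g f) = comp (comp h g) f }.

Arguments hom {c} X Y.
Arguments idm {c} X.
Arguments comp {c X Y Z} g f.

Declare Scope markov_scope.
Delimit Scope markov_scope with M.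
Local Open Scope markov_scope.
Notation "g ∘ f" := (comp g f) (at level 50, left associativity) : markov_scope.

Definition mutually_inverse (C : category) (X Y : C) (f : hom X Y) (g : hom Y X)
  : Prop := g ∘ f = idm X /\ f ∘ g = idm Y.

Record symmonoidal := SymMonoidal {
  smcat :> category;
  ox : smcat -> smcat -> smcat;
  tens : forall X X' Y Y' : smcat,
    hom X X' -> hom Y Y' -> hom (ox X Y) (ox X' Y');
  munit : smcat;
  assoc : forall X Y Z, hom (ox (ox X Y) Z) (ox X (ox Y Z));
  assocV : forall X Y Z, hom (ox X (ox Y Z)) (ox (ox X Y) Z);
  lun : forall X, hom (ox munit X) X;
  lunV : forall X, hom X (ox munit X);
  run : forall X, hom (ox X munit) X;
  runV : forall X, hom X (ox X munit);
  swap : forall X Y, hom (ox X Y) (ox Y X);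
  tens_id : forall X Y, tens (idm X) (idm Y) = idm (ox X Y);
  tens_comp : forall X X' X'' Y Y' Y''
      (f' : hom X' X'') (f : hom X X') (g' : hom Y' Y'') (g : hom Y Y'),
    tens (f' ∘ f) (g' ∘ g) = tens f' g' ∘ tens f g;
  assoc_iso : forall X Y Z, mutually_inverse (assoc X Y Z) (assocV X Y Z);
  lun_iso : forall X, mutually_inverse (lun X) (lunV X);
  run_iso : forall X, mutually_inverse (run X) (runV X);
  assoc_nat : forall X X' Y Y' Z Z'
      (f : hom X X') (g : hom Y Y') (h : hom Z Z'),
    assoc X' Y' Z' ∘ tens (tens f g) h = tens f (tens g h) ∘ assoc X Y Z;
  lun_nat : forall X X' (f : hom X X'), lun X' ∘ tens (idm munit) f = f ∘ lun X;
  run_nat : forall X X' (f : hom X X'), run X' ∘ tens f (idm munit) = f ∘ run X;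
  swap_nat : forall X X' Y Y' (f : hom X X') (g : hom Y Y'),
    swap X' Y' ∘ tens f g = tens g f ∘ swap X Y;
  pentagon : forall X Y Z T,
    assoc X Y (ox Z T) ∘ assoc (ox X Y) Z T
    = tens (idm X) (assoc Y Z T) ∘ assoc X (ox Y Z) T
      ∘ tens (assoc X Y Z) (idm T);
  triangle : forall X Y,
    tens (idm X) (lun Y) ∘ assoc X munit Y = tens (run X) (idm Y);
  hexagon : forall X Y Z,
    assoc Y Z X ∘ swap X (ox Y Z) ∘ assoc X Y Z
    = tens (idm Y) (swap X Z) ∘ assoc Y X Z ∘ tens (swap X Y) (idm Z);
  swap_swap : forall X Y, swap Y X ∘ swap X Y = idm (ox X Y) }.

Arguments ox {s} X Y.
Arguments tens {s X X' Y Y'} f g.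
Arguments munit {s}.
Arguments assoc {s} X Y Z.
Arguments assocV {s} X Y Z.
Arguments lun {s} X.
Arguments lunV {s} X.
Arguments run {s} X.
Arguments runV {s} X.
Arguments swap {s} X Y.

Notation "X ⊗ Y" := (ox X Y) (at level 40, left associativity) : markov_scope.
Notation "f ⊠ g" := (tens f g) (at level 40, left associativity) : markov_scope.

Definition midswap (C : symmonoidal) (X Y Z T : C)
  : hom ((X ⊗ Y) ⊗ (Z ⊗ T)) ((X ⊗ Z) ⊗ (Y ⊗ T)) :=
  assocV X Z (Y ⊗ T)
  ∘ (idm X ⊠ (assoc Z Y T ∘ (swap Y Z ⊠ idm T) ∘ assocV Y Z T))
  ∘ assoc X Y (Z ⊗ T).

Record markov := Markov {
  msm :> symmonoidal;
  copy : forall X : msm, hom X (X ⊗ X);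
  del : forall X : msm, hom X munit;
  copy_coassoc : forall X,
    assoc X X X ∘ (copy X ⊠ idm X) ∘ copy X = (idm X ⊠ copy X) ∘ copy X;
  copy_lcounit : forall X, lun X ∘ (del X ⊠ idm X) ∘ copy X = idm X;
  copy_rcounit : forall X, run X ∘ (idm X ⊠ del X) ∘ copy X = idm X;
  copy_comm : forall X, swap X X ∘ copy X = copy X;
  copy_tens : forall X Y,
    copy (X ⊗ Y) = midswap X X Y Y ∘ (copy X ⊠ copy Y);
  del_tens : forall X Y, del (X ⊗ Y) = lun munit ∘ (del X ⊠ del Y);
  copy_unit : copy munit = lunV munit;
  del_unit : del munit = idm munit;
  del_nat : forall X Y (f : hom X Y), del Y ∘ f = del X }.

Arguments copy {m} X.
Arguments del {m} X.

Section MarkovNotions.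
Variable C : markov.

Definition marginal (A X Y : C) (f : hom A (X ⊗ Y)) : hom A X :=
  run X ∘ (idm X ⊠ del Y) ∘ f.

Definition is_conditional (A X Y : C) (f : hom A (X ⊗ Y)) (c : hom (X ⊗ A) Y)
  : Prop :=
  f = (idm X ⊠ c) ∘ assoc X X A ∘ (copy X ⊠ idm A)
      ∘ (marginal f ⊠ idm A) ∘ copy A.

Definition has_conditionals : Prop :=
  forall (A X Y : C) (f : hom A (X ⊗ Y)), exists c, is_conditional f c.

Definition as_equal (A X : C) (p : hom A X) (W Y : C) (f1 f2 : hom (W ⊗ X) Y)
  : Prop :=
  (f1 ⊠ idm X) ∘ assocV W X X ∘ (idm W ⊠ (copy X ∘ p))
  = (f2 ⊠ idm X) ∘ assocV W X X ∘ (idm W ⊠ (copy X ∘ p)).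

Definition abs_cont (A B X : C) (p : hom A X) (q : hom B X) : Prop :=
  forall (W Y : C) (f1 f2 : hom (W ⊗ X) Y),
    as_equal q f1 f2 -> as_equal p f1 f2.

Definition atomic_hom (A X : C) (p : hom A X) : Prop :=
  abs_cont (copy X ∘ p) (p ⊠ p).

Definition atomic : Prop := forall (A X : C) (p : hom A X), atomic_hom p.

Definition cancellable (W : C) : Prop :=
  forall (X Y : C) (f1 f2 : hom X Y), del W ⊠ f1 = del W ⊠ f2 -> f1 = f2.

Definition cancellative : Prop := forall W : C, cancellable W.

End MarkovNotions.

(* The set B_{m,n} of the boxes with m inputs and n outputs is the set of the *)
(* b : box with size (inw b) = m and size (outw b) = n.                       *)
Record hypergraph := Hypergraph {
  wire : Type;
  box : Type;
  inw : box -> seq wire;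
  outw : box -> seq wire }.

Arguments inw {h} b.
Arguments outw {h} b.

Definition is_hypergraph_hom (G H : hypergraph)
    (hw : wire G -> wire H) (hb : box G -> box H) : Prop :=
  forall b, inw (hb b) = map hw (inw b) /\ outw (hb b) = map hw (outw b).

Notation signature := hypergraph.

(* A finite hypergraph with a labelling of its wires and boxes in S, not yet  *)
(* required to be a homomorphism (see [lgraph_over] below).                   *)
Record lgraph (S : signature) := LGraph {
  gwire : finType;
  gbox : finType;
  gin : gbox -> seq gwire;
  gout : gbox -> seq gwire;
  wlab : gwire -> wire S;
  blab : gbox -> box S }.

Arguments gwire {S} l.
Arguments gbox {S} l.
Arguments gin {S l} b.
Arguments gout {S l} b.
Arguments wlab {S l} w.
Arguments blab {S l} b.

Definition hypergraph_of S (G : lgraph S) : hypergraph :=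
  Hypergraph (@gin S G) (@gout S G).

Definition lgraph_over S (G : lgraph S) : Prop :=
  @is_hypergraph_hom (hypergraph_of G) S (@wlab S G) (@blab S G).

(* A homomorphism from a discrete hypergraph with m wires to G is a sequence  *)
(* of m wires of G.  The two legs of a cospan are encoded in this way, and so *)
(* are the objects of the free Markov category (sequences of types).          *)
Record cospan (S : signature) := Cospan {
  apex :> lgraph S;
  lleg : seq (gwire apex);
  rleg : seq (gwire apex) }.

Arguments lleg {S} c.
Arguments rleg {S} c.

Definition cospan_iso S (D E : cospan S) : Prop :=
  exists (fw : gwire D -> gwire E) (fb : gbox D -> gbox E),
    [/\ bijective fw, bijective fb,
        @is_hypergraph_hom (hypergraph_of D) (hypergraph_of E) fw fb,
        (forall w, wlab (fw w) = wlab w) /\ (forall b, blab (fb b) = blab b)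
      & lleg E = map fw (lleg D) /\ rleg E = map fw (rleg D)].

Section Conditions.
Variables (S : signature).

Definition hstep (G : lgraph S) : rel (gwire G) :=
  fun w w' => [exists b : gbox G, (w \in gin b) && (w' \in gout b)].

Definition acyclic (G : lgraph S) : Prop :=
  forall s : seq (gwire G), cycle (@hstep G) s -> s = [::].

Definition left_monogamous (D : cospan S) : Prop :=
  forall w : gwire D,
    count_mem w (lleg D) + \sum_(b : gbox D) count_mem w (gout b) = 1.

Definition eliminable (D : cospan S) : pred (gbox D) := fun b =>
  all (fun w => (w \notin rleg D) && [forall b' : gbox D, w \notin gin b'])
      (gout b).

Record premarkov (D : cospan S) : Prop := PreMarkov {
  pm_over : lgraph_over D;
  pm_acyclic : acyclic D;
  pm_mono : left_monogamous D }.

Definition normal (D : cospan S) : Prop :=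
  forall b : gbox D, ~~ eliminable b.

End Conditions.

Arguments hstep {S} G.
Arguments eliminable {S} D.

(* The morphisms m -> n of the free Markov category are the diagrams up to    *)
(* [cospan_iso].                                                              *)
Record diagram (S : signature) (m n : seq (wire S)) := Diagram {
  dgm :> cospan S;
  dgm_dom : map wlab (lleg dgm) = m;
  dgm_cod : map wlab (rleg dgm) = n;
  dgm_pre : premarkov dgm;
  dgm_normal : normal dgm }.

Section Normalize.
Variable S : signature.

(* For b eliminable and D left monogamous, [restr] only discards wires from   *)
(* the output list of b itself, so that no input, output or leg is lost.      *)
Definition delete_box (D : cospan S) (b : gbox D) : cospan S :=
  let W := {w : gwire D | w \notin gout b} in
  let restr := pmap (insub : gwire D -> option W) in
  @Cospan S
    (@LGraph S W {b' : gbox D | b' != b}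
       (fun b' => restr (gin (val b'))) (fun b' => restr (gout (val b')))
       (fun w => wlab (val w)) (fun b' => blab (val b')))
    (restr (lleg D)) (restr (rleg D)).

Definition delete_eliminable (D : cospan S) : cospan S :=
  if [pick b | eliminable D b] is Some b then delete_box b else D.

(* Each effective step removes one box, so #|gbox D| steps are enough (see    *)
(* [normalize_normal]).  The order of deletion is irrelevant up to            *)
(* isomorphism.                                                               *)
Definition normalize (D : cospan S) : cospan S :=
  iter #|gbox D| delete_eliminable D.

End Normalize.

Section Gluing.
Variables (A B : finType) (s : seq A) (t : seq B).

Definition glue_rel : rel (A + B) := fun x y =>
  match x, y with
  | inl a, inr b | inr b, inl a => (a, b) \in zip s t
  | _, _ => false
  end.

Lemma glue_sym : connect_sym glue_rel.
Proof. by apply: sym_connect_sym => -[a|b] [a'|b']. Qed.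

(* The quotient of A + B by the equivalence generated by [glue_rel],          *)
(* represented by the canonical representatives of the classes.               *)
Definition glued : finType := {x : A + B | roots glue_rel x}.

Definition glue (x : A + B) : glued :=
  Sub (root glue_rel x) (roots_root glue_sym x).

Lemma glue_val x : connect glue_rel x (val (glue x)).
Proof. exact: connect_root. Qed.

Lemma glue_eqP x y : reflect (glue x = glue y) (connect glue_rel x y).
Proof.
apply: (iffP idP) => [/(rootP glue_sym) exy|/(congr1 val)/(rootP glue_sym) //].
exact: val_inj.
Qed.

Lemma valK_glue c : glue (val c) = c.
Proof. by apply: val_inj => /=; apply/eqP; exact: (valP c). Qed.

Lemma glue_step a b : (a, b) \in zip s t -> connect glue_rel (inl a) (inr b).
Proof. by move=> ab; apply: connect1. Qed.

Lemma glue_inv (T : Type) (F : A + B -> T) :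
    (forall a b, (a, b) \in zip s t -> F (inl a) = F (inr b)) ->
  forall x y, connect glue_rel x y -> F x = F y.
Proof.
move=> FE; have Fstep x y : glue_rel x y -> F x = F y.
  by case: x y => [a|b] [a'|b'] //= /FE // ->.
move=> x y /connectP[p]; elim: p x => [|z p IHp] x /= => [_ -> //|].
by case/andP=> /Fstep-> /IHp H /H.
Qed.

End Gluing.

Section Pushout.
Variable S : signature.

(* The pushout of G and H along the homomorphisms s and t from a discrete     *)
(* hypergraph (size s = size t).                                              *)
Definition pushout (G H : lgraph S) (s : seq (gwire G)) (t : seq (gwire H))
  : lgraph S :=
  @LGraph S (glued s t) (gbox G + gbox H)%type
    (fun b => match b with
              | inl b => map (fun w => glue s t (inl w)) (gin b)
              | inr b => map (fun w => glue s t (inr w)) (gin b)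
              end)
    (fun b => match b with
              | inl b => map (fun w => glue s t (inl w)) (gout b)
              | inr b => map (fun w => glue s t (inr w)) (gout b)
              end)
    (fun w => match val w with inl w => wlab w | inr w => wlab w end)
    (fun b => match b with inl b => blab b | inr b => blab b end).

Definition discrete (m : seq (wire S)) : lgraph S :=
  @LGraph S 'I_(size m) void
    (fun b => match b with end) (fun b => match b with end)
    (tnth (in_tuple m)) (fun b => match b with end).

Definition wires (m : seq (wire S)) : seq (gwire (discrete m)) :=
  enum 'I_(size m).

Definition coproduct (G H : lgraph S) : lgraph S :=
  @LGraph S (gwire G + gwire H)%type (gbox G + gbox H)%type
    (fun b => match b with
              | inl b => map inl (gin b) | inr b => map inr (gin b) end)
    (fun b => match b with
              | inl b => map inl (gout b) | inr b => map inr (gout b) end)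
    (fun w => match w with inl w => wlab w | inr w => wlab w end)
    (fun b => match b with inl b => blab b | inr b => blab b end).

Definition cospan_wiring (m : seq (wire S)) (s : seq 'I_(size m)) : cospan S :=
  @Cospan S (discrete m) (wires m) s.

Definition cospan_tensor (D E : cospan S) : cospan S :=
  @Cospan S (coproduct D E)
    (map inl (lleg D) ++ map inr (lleg E))
    (map inl (rleg D) ++ map inr (rleg E)).

Definition cospan_precomp (E D : cospan S) : cospan S :=
  @Cospan S (pushout (rleg D) (lleg E))
    (map (fun w => glue (rleg D) (lleg E) (inl w)) (lleg D))
    (map (fun w => glue (rleg D) (lleg E) (inr w)) (rleg E)).

(* With lleg D = i ++ i' and rleg D = j ++ j', where i, j are of respective   *)
(* sizes m, n and i', j' of size (size w), this is the cospan obtained from   *)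
(* the pushout of [i', j'] along the codiagonal of w.                         *)
Definition cospan_precontr (m n : nat) (w : seq (wire S)) (D : cospan S)
  : cospan S :=
  let s := drop m (lleg D) ++ drop n (rleg D) in
  let t := wires w ++ wires w in
  @Cospan S (@pushout D (discrete w) s t)
    (map (fun x => glue s t (inl x)) (take m (lleg D)))
    (map (fun x => glue s t (inl x)) (take n (rleg D))).

End Pushout.

Section Closure.
Variable S : signature.

Lemma rank_acyclic (G : lgraph S) (r : gwire G -> nat) :
    (forall b w w', w \in gin b -> w' \in gout b -> r w < r w') ->
  acyclic G.
Proof.
move=> rP; have Hr w w' : hstep G w w' -> r w < r w'.
  by case/existsP=> b /andP[]; apply: rP.
case=> // x p /= cyc.
have Hle y q z : path (hstep G) y (rcons q z) -> r y < r z.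
  elim: q y => [|u q IHq] y /=; first by rewrite andbT; apply: Hr.
  by case/andP=> /Hr Hyu /IHq; apply: ltn_trans.
by have := Hle _ _ _ cyc; rewrite ltnn.
Qed.

Lemma acyclic_rank (G : lgraph S) : acyclic G ->
  exists r : gwire G -> nat,
    forall b w w', w \in gin b -> w' \in gout b -> r w < r w'.
Proof.
move=> acG; exists (fun w => #|[pred x | connect (hstep G) x w]|).
move=> b w w' wb w'b.
have eww' : hstep G w w' by apply/existsP; exists b; rewrite wb.
apply: proper_card; apply/properP; split.
  apply/subsetP=> x; rewrite !inE => /connect_trans; apply.
  exact: connect1.
exists w'; rewrite !inE ?connect0 //; apply/negP => /connectP[p pp ew].
have := acG (w' :: p); rewrite /= rcons_path pp -ew eww' => /(_ isT).
by [].
Qed.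

Lemma map_val_insub (T : Type) (P : pred T) (sT : subType P) (l : seq T) :
  all P l -> map val (pmap (insub : T -> option sT) l) = l.
Proof.
elim: l => //= x l IHl /andP[Px /IHl Hl].
by rewrite insubT /= SubK Hl.
Qed.

Lemma count_mem_val (T : eqType) (P : pred T) (sT : subEqType P)
    (x : sT) (l : seq sT) :
  count_mem x l = count_mem (val x) (map val l).
Proof. by rewrite count_map; apply: eq_count => y /=; rewrite (inj_eq val_inj). Qed.

Section Delete.
Variables (D : cospan S) (b : gbox D).
Hypotheses (monoD : left_monogamous D) (elb : eliminable D b).

Let W := {w : gwire D | w \notin gout b}.

Let lleg_notin : all (fun w => w \notin gout b) (lleg D).
Proof.
apply/allP=> w wl; apply/negP => wb.
have := monoD w; rewrite (bigD1 b) //=.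
move: wl wb; rewrite -!has_pred1 !has_count.
by case: (count _ _) => // ?; case: (count _ _) => // ? _ _; rewrite addSn addSn addnS.
Qed.

Let rleg_notin : all (fun w => w \notin gout b) (rleg D).
Proof.
apply/allP=> w wl; apply/negP => wb.
by have /allP/(_ w wb)/andP[] := elb; rewrite wl.
Qed.

Let gin_notin (c : gbox D) : all (fun w => w \notin gout b) (gin c).
Proof.
apply/allP=> w wl; apply/negP => wb.
by have /allP/(_ w wb)/andP[_ /forallP/(_ c)] := elb; rewrite wl.
Qed.

Let gout_notin (c : gbox D) : c != b -> all (fun w => w \notin gout b) (gout c).
Proof.
move=> cb; apply/allP=> w wl; apply/negP => wb.
have := monoD w; rewrite (bigD1 b) //= (bigD1 c) //=.
move: wl wb; rewrite -!has_pred1 !has_count.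
case: (count_mem w (gout c)) => // ?; case: (count_mem w (gout b)) => // ? _ _.
by rewrite addnCA addSn !addnS.
Qed.

Lemma delete_lleg : map val (lleg (delete_box b)) = lleg D.
Proof. exact: map_val_insub. Qed.

Lemma delete_rleg : map val (rleg (delete_box b)) = rleg D.
Proof. exact: map_val_insub. Qed.

Lemma delete_gin (c : gbox (delete_box b)) : map val (gin c) = gin (val c).
Proof. exact: map_val_insub. Qed.

Lemma delete_gout (c : gbox (delete_box b)) : map val (gout c) = gout (val c).
Proof. by apply: map_val_insub; apply: gout_notin; apply: (valP c). Qed.

Lemma delete_premarkov : premarkov D -> premarkov (delete_box b).
Proof.
case=> ovD acD _; split.
- move=> c; have [/= e1 e2] := ovD (val c); split.
  + by rewrite e1 -[in LHS]delete_gin -map_comp.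
  + by rewrite e2 -[in LHS]delete_gout -map_comp.
- have [r rP] := acyclic_rank acD; apply: (@rank_acyclic (delete_box b) (fun w => r (val w))).
  move=> c w w' wc w'c; apply: (rP (val c)).
  + by rewrite -delete_gin map_f.
  + by rewrite -delete_gout map_f.
- move=> w; rewrite count_mem_val delete_lleg -[RHS](monoD (val w)).
  congr (_ + _); rewrite [RHS](bigD1 b) //= (count_memPn _) ?add0n; last exact: (valP w).
  under eq_bigr => c _ do rewrite count_mem_val delete_gout.
  rewrite [RHS](reindex_omap (val : gbox (delete_box b) -> gbox D) insub) /=.
    by apply: eq_bigl => c; rewrite [insub _]valK eqxx andbT; apply/esym/(valP c).
  by move=> c cb; rewrite insubT.
Qed.

Lemma delete_card : #|gbox (delete_box b)| < #|gbox D|.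
Proof. by rewrite card_sig cardC1 prednK //; apply/card_gt0P; exists b. Qed.

Lemma delete_connect (w w' : gwire (delete_box b)) :
    val w' \in rleg D ->
  connect (hstep D) (val w) (val w') ->
  connect (hstep (delete_box b)) w w'.
Proof.
move=> w'r /connectP[p]; elim: p w => [|x p IHp] w /=.
  by move=> _ /val_inj->.
case/andP=> /existsP[c /andP[wc xc]] pp ew.
have xNb : x \notin gout b.
  case: p pp ew {IHp} => [|y p] /=.
    by move=> _ <-; exact: (allP rleg_notin).
  by case/andP=> /existsP[d /andP[xd _]] _ _; exact: (allP (gin_notin d)).
have cb : c != b by apply: contraNneq xNb => <-.
apply: connect_trans (IHp (Sub x xNb) _ _); rewrite ?SubK //.
apply: connect1; apply/existsP; exists (Sub c cb : gbox (delete_box b)).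
have := delete_gin (Sub c cb); have := delete_gout (Sub c cb).
rewrite !SubK => eo ei; rewrite -(mem_map val_inj) ei wc.
by rewrite -(mem_map val_inj (_ : seq (gwire (delete_box b)))) eo SubK.
Qed.

End Delete.

(* Input number k is connected to output number l.                            *)
Definition io_connected (D : cospan S) (k l : nat) : Prop :=
  exists a c, [/\ onth (lleg D) k = Some a, onth (rleg D) l = Some c
                & connect (hstep D) a c].

Lemma delete_io (D : cospan S) b k l : left_monogamous D -> eliminable D b ->
  io_connected D k l -> io_connected (delete_box b) k l.
Proof.
move=> mD elb [a [c [ka lc ac]]].
have := ka; rewrite -(delete_lleg b mD) onth_map.
case ka': (onth _ k) => [a'|] //= ea; have {}ea : val a' = a by case: ea.
have := lc; rewrite -(delete_rleg elb) onth_map.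
case lc': (onth _ l) => [c'|] //= ec; have {}ec : val c' = c by case: ec.
exists a', c'; split=> //; apply: delete_connect => //.
  by rewrite ec; apply/onthP; exists l.
by rewrite ea ec.
Qed.

Lemma delete_eliminable_premarkov (D : cospan S) :
  premarkov D -> premarkov (delete_eliminable D).
Proof.
rewrite /delete_eliminable; case: pickP => // b elb pD.
by apply: delete_premarkov => //; case: pD.
Qed.

Lemma normalize_premarkov (D : cospan S) :
  premarkov D -> premarkov (normalize D).
Proof.
rewrite /normalize; elim: #|_| => //= n IHn pD.
exact/delete_eliminable_premarkov/IHn.
Qed.

Lemma normalize_normal (D : cospan S) : premarkov D -> normal (normalize D).
Proof.
suff H n : #|gbox D| <= n -> premarkov D ->
    normal (iter n (@delete_eliminable S) D) by apply: H.
elim: n D => [|n IHn] D leD pD.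
  by move=> b; move: leD; rewrite leqn0 => /eqP/card0_eq/(_ b).
rewrite iterSr {2}/delete_eliminable; case: pickP => [b elb|el0].
  apply: IHn; last by apply: delete_premarkov => //; case: pD.
  by rewrite -ltnS; apply: leq_trans leD; apply: delete_card.
suff -> : iter n (@delete_eliminable S) D = D by move=> b; have := el0 b; move=> ->.
by elim: n {IHn leD} => //= n ->; rewrite /delete_eliminable; case: pickP => // b; rewrite el0.
Qed.

Lemma normalize_legs (D : cospan S) : premarkov D ->
  map wlab (lleg (normalize D)) = map wlab (lleg D) /\
  map wlab (rleg (normalize D)) = map wlab (rleg D).
Proof.
rewrite /normalize; move: #|gbox D| => n pD; elim: n D pD => // n IHn E pE.
rewrite iterSr; have [-> ->] := IHn _ (delete_eliminable_premarkov pE).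
rewrite /delete_eliminable; case: pickP => // b elb.
split.
- by rewrite -[in RHS](delete_lleg b (pm_mono pE)) -map_comp.
- by rewrite -[in RHS](delete_rleg elb) -map_comp.
Qed.

Lemma normalize_io (D : cospan S) k l : premarkov D ->
  io_connected D k l -> io_connected (normalize D) k l.
Proof.
rewrite /normalize; move: #|gbox D| => n pD; elim: n D pD => // n IHn E pE ioE.
rewrite iterSr; apply: IHn; first exact: delete_eliminable_premarkov.
rewrite /delete_eliminable; case: pickP => // b elb.
by apply: delete_io => //; case: pE.
Qed.

Lemma iso_io (D E : cospan S) k l : cospan_iso D E ->
  io_connected D k l -> io_connected E k l.
Proof.
case=> fw [fb [_ _ hf _ [le re]]] [a [c [ka lc ac]]].
exists (fw a), (fw c); rewrite le re !onth_map ka lc; split=> //.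
case/connectP: ac => p; elim: p a {ka} => [|x p IHp] a /=.
  by move=> _ ->; apply: connect0.
case/andP=> /existsP[b /andP[ab xb]] pp ec.
apply: connect_trans (IHp _ pp ec); apply: connect1; apply/existsP.
by exists (fb b); have [/= -> ->] := hf b; rewrite !map_f.
Qed.

End Closure.

Section Closure2.
Variable S : signature.

Lemma zip_map_eq (A B : eqType) (T : Type) (f : A -> T) (g : B -> T) s t a b :
  map f s = map g t -> (a, b) \in zip s t -> f a = g b.
Proof.
elim: s t => [|x s IHs] [|y t] //= [exy est]; rewrite inE => /orP[|/IHs->//].
by case/eqP=> -> ->.
Qed.

Lemma zip_onth (A B : eqType) (s : seq A) (t : seq B) a b :
  (a, b) \in zip s t -> exists k, onth s k = Some a /\ onth t k = Some b.
Proof.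
elim: s t => [|x s IHs] [|y t] //=; rewrite inE => /orP[/eqP[-> ->]|].
  by exists 0.
by case/IHs=> k [ek fk]; exists k.+1.
Qed.

Lemma onth_zip (A B : eqType) (s : seq A) (t : seq B) a b k :
  onth s k = Some a -> onth t k = Some b -> (a, b) \in zip s t.
Proof.
elim: s t k => [|x s IHs] [|y t] [|k] //=; rewrite inE.
  by case=> -> [->]; rewrite eqxx.
by move=> sk tk; rewrite (IHs t k) ?orbT.
Qed.

Lemma onth_index (A : eqType) (s : seq A) a : a \in s -> onth s (index a s) = Some a.
Proof.
elim: s => //= x s IHs; rewrite inE eq_sym; case: eqP => [-> //|_] /=; exact: IHs.
Qed.

Lemma index_onth (A : eqType) (s : seq A) a k :
  uniq s -> onth s k = Some a -> index a s = k.
Proof.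
elim: s k => [|x s IHs] [|k] //= /andP[xs us]; first by case=> ->; rewrite eqxx.
move=> sk; rewrite (IHs k) //; case: eqP => // xa; case/negP: xs.
by rewrite xa; apply/onthP; exists k.
Qed.

Lemma onth_mem (A : eqType) (s : seq A) a k : onth s k = Some a -> a \in s.
Proof. by move=> sk; apply/onthP; exists k. Qed.

Lemma onth_enum_ord n (k : 'I_n) : onth (enum 'I_n) k = Some k.
Proof.
have Hk : k < size (enum 'I_n) by rewrite size_enum_ord.
by have := onth_index (mem_enum 'I_n k); rewrite index_enum_ord.
Qed.

Section PushoutLemmas.
Variables (G H : lgraph S) (s : seq (gwire G)) (t : seq (gwire H)).
Hypothesis labE : map wlab s = map wlab t.

Lemma pushout_wlab (x : gwire G + gwire H) :
  wlab (glue s t x : gwire (pushout s t))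
  = match x with inl w => wlab w | inr w => wlab w end.
Proof.
apply: (glue_inv (F := fun y : gwire G + gwire H =>
  match y with inl w => wlab w | inr w => wlab w end)); last first.
  by rewrite glue_sym; apply: glue_val.
by move=> a b; apply: zip_map_eq.
Qed.

Lemma pushout_over :
  lgraph_over G -> lgraph_over H -> lgraph_over (pushout s t).
Proof.
move=> oG oH [b|b] /=; [have [/= -> ->] := oG b | have [/= -> ->] := oH b];
  by split; rewrite -map_comp; apply: eq_map => w /=; rewrite [RHS]pushout_wlab.
Qed.

End PushoutLemmas.

Section PushoutRank.
Variables (G H : lgraph S) (s : seq (gwire G)) (t : seq (gwire H)).

Lemma pushout_acyclic (F : gwire G + gwire H -> nat) :
    (forall a b, (a, b) \in zip s t -> F (inl a) = F (inr b)) ->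
    (forall (b : gbox G) w w', w \in gin b -> w' \in gout b ->
       F (inl w) < F (inl w')) ->
    (forall (b : gbox H) w w', w \in gin b -> w' \in gout b ->
       F (inr w) < F (inr w')) ->
  acyclic (pushout s t).
Proof.
move=> FE FG FH.
have Fval x : F (val (glue s t x)) = F x.
  by apply: (glue_inv FE); rewrite glue_sym; apply: glue_val.
apply: (@rank_acyclic _ (pushout s t) (fun c => F (val c))).
by case=> b _ _ /mapP[w wb ->] /mapP[w' w'b ->]; rewrite !Fval;
   [apply: FG wb w'b | apply: FH wb w'b].
Qed.

Lemma count_glue (phi : gwire G + gwire H -> gwire G + gwire H)
    (T : eqType) (f : T -> gwire G + gwire H) (c : glued s t) (L : seq T) :
    (forall a b, (a, b) \in zip s t -> phi (inl a) = phi (inr b)) ->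
    (forall x, connect (glue_rel s t) x (phi x)) ->
  count_mem c (map (fun w => glue s t (f w)) L)
  = count (fun w => phi (f w) == phi (val c)) L.
Proof.
move=> phiE phiC; rewrite count_map; apply: eq_count => w /=.
rewrite -{1}(valK_glue c); apply/eqP/eqP => [/glue_eqP|e]; first exact: glue_inv.
apply/glue_eqP; apply: connect_trans (phiC _) _; rewrite e glue_sym; exact: phiC.
Qed.

Lemma pushout_connect (w w' : gwire G) : connect (hstep G) w w' ->
  connect (hstep (pushout s t)) (glue s t (inl w)) (glue s t (inl w')).
Proof.
case/connectP=> p; elim: p w => [|x p IHp] w /=; first by move=> _ ->.
case/andP=> /existsP[b /andP[wb xb]] pp ew.
apply: connect_trans (IHp _ pp ew); apply: connect1; apply/existsP.
exists (inl b : gbox (pushout s t)).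
by apply/andP; split; apply: (map_f (fun w => glue s t (inl w))).
Qed.

End PushoutRank.

Lemma mono_uniq (D : cospan S) : left_monogamous D -> uniq (lleg D).
Proof.
move=> mD; apply: count_mem_uniq => w; have := mD w.
rewrite -has_pred1 has_count; case: (count _ _) => [|[|n]] //.
Qed.

Lemma mono_out (D : cospan S) (b : gbox D) w :
  left_monogamous D -> w \in gout b -> w \notin lleg D.
Proof.
move=> mD wb; apply/negP => wl; have := mD w; rewrite (bigD1 b) //=.
move: wl wb; rewrite -!has_pred1 !has_count.
by case: (count _ _) => // ?; case: (count _ _) => // ? _ _; rewrite addSn addSn addnS.
Qed.

Lemma map_wires (m : seq (wire S)) : map (@wlab S (discrete m)) (wires m) = m.
Proof. by rewrite /= map_tnth_enum. Qed.

Lemma wiring_premarkov (m : seq (wire S)) (s : seq 'I_(size m)) :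
  premarkov (cospan_wiring s).
Proof.
split; first by case.
  by apply: (@rank_acyclic _ _ (fun=> 0)) => -[].
move=> w; rewrite big_pred0 ?addn0; last by case.
by rewrite count_uniq_mem ?enum_uniq // mem_enum.
Qed.

Lemma wiring_normal (m : seq (wire S)) (s : seq 'I_(size m)) :
  normal (cospan_wiring s).
Proof. by case. Qed.

Lemma count_inl (A B : eqType) (a : A) (l : seq A) :
  count_mem (inl a : A + B) (map inl l) = count_mem a l.
Proof. by rewrite count_map; apply: eq_count => x /=; rewrite (inj_eq (@inl_inj _ _)). Qed.

Lemma count_inr (A B : eqType) (b : B) (l : seq B) :
  count_mem (inr b : A + B) (map inr l) = count_mem b l.
Proof. by rewrite count_map; apply: eq_count => x /=; rewrite (inj_eq (@inr_inj _ _)). Qed.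

Lemma count_inlr (A B : eqType) (b : B) (l : seq A) :
  count_mem (inr b : A + B) (map inl l) = 0.
Proof. by rewrite count_map count_pred0. Qed.

Lemma count_inrl (A B : eqType) (a : A) (l : seq B) :
  count_mem (inl a : A + B) (map inr l) = 0.
Proof. by rewrite count_map count_pred0. Qed.

Lemma tensor_premarkov (D E : cospan S) :
  premarkov D -> premarkov E -> premarkov (cospan_tensor D E).
Proof.
move=> [oD aD mD] [oE aE mE]; split.
- by case=> b /=; [have [/= -> ->] := oD b | have [/= -> ->] := oE b];
     split; rewrite -map_comp.
- have [[rD rDP] [rE rEP]] := (acyclic_rank aD, acyclic_rank aE).
  apply: (@rank_acyclic _ (coproduct D E)
    (fun w => match w with inl w => rD w | inr w => rE w end)).
  by case=> b _ _ /mapP[w wb ->] /mapP[w' w'b ->];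
     [apply: rDP wb w'b | apply: rEP wb w'b].
- move=> w; rewrite big_sumType /= count_cat.
  case: w => w.
  + rewrite count_inl count_inrl addn0 -[RHS](mD w) addnA [X in _ + X]big1.
      by rewrite addn0; congr (_ + _); apply: eq_bigr => b _; rewrite count_inl.
    by move=> b _; rewrite count_inrl.
  + rewrite count_inlr count_inr add0n -[RHS](mE w) [X in _ + (X + _)]big1.
      by rewrite add0n; congr (_ + _); apply: eq_bigr => b _; rewrite count_inr.
    by move=> b _; rewrite count_inlr.
Qed.

Lemma tensor_normal (D E : cospan S) :
  normal D -> normal E -> normal (cospan_tensor D E).
Proof.
move=> nD nE [b|b]; [apply: contra (nD b) | apply: contra (nE b)].
- move/allP=> H; apply/allP=> w wb.
  have /andP[wr /forallP wi] := H (inl w) (map_f _ wb); apply/andP; split.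
    by apply: contra wr => wr; rewrite mem_cat map_f.
  by apply/forallP => c; apply: contra (wi (inl c)) => wc; apply: map_f.
- move/allP=> H; apply/allP=> w wb.
  have /andP[wr /forallP wi] := H (inr w) (map_f _ wb); apply/andP; split.
    by apply: contra wr => wr; rewrite mem_cat map_f ?orbT.
  by apply/forallP => c; apply: contra (wi (inr c)) => wc; apply: map_f.
Qed.

Lemma precomp_premarkov (E D : cospan S) :
    map wlab (rleg D) = map wlab (lleg E) ->
  premarkov E -> premarkov D -> premarkov (cospan_precomp E D).
Proof.
move=> labE [oE aE mE] [oD aD mD].
have sizeE : size (rleg D) = size (lleg E).
  by rewrite -(size_map wlab) labE size_map.
have uE := mono_uniq mE.
pose phi (x : gwire D + gwire E) : gwire D + gwire E := match x with
  | inl a => inl a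
  | inr v => if onth (rleg D) (index v (lleg E)) is Some a then inl a else inr v
  end.
have phiE a b : (a, b) \in zip (rleg D) (lleg E) -> phi (inl a) = phi (inr b).
  by case/zip_onth=> k [ka kb] /=; rewrite (index_onth uE kb) ka.
have phiN v : v \notin lleg E -> phi (inr v) = inr v.
  by move=> vE; rewrite /phi memNindex // onth_default // sizeE.
have phiI v : v \in lleg E -> exists a, phi (inr v) = inl a.
  rewrite -index_mem -sizeE -onthTE /phi.
  by case: (onth _ _) => // a _; exists a.
have phiC x : connect (glue_rel (rleg D) (lleg E)) x (phi x).
  case: x => [a|v] //=; case Da: (onth _ _) => [a|] //.
  rewrite glue_sym; apply/glue_step/(onth_zip Da)/onth_index.
  by rewrite -index_mem -sizeE -onthTE Da.
split; first exact: pushout_over.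
- have [[rD rDP] [rE rEP]] := (acyclic_rank aD, acyclic_rank aE).
  pose R (x : gwire D + gwire E) := match x with
    | inl a => rD a | inr v => (\max_a rD a).+1 + rE v end.
  apply: (pushout_acyclic (F := fun x => R (phi x))).
  + by move=> a b /phiE->.
  + by move=> b w w'; apply: rDP.
  + move=> b w w' wb w'b; rewrite (phiN w') ?(mono_out mE w'b) //.
    have [/phiI[a ->]|/phiN->] := boolP (w \in lleg E).
      by rewrite /= addSn ltnS (leq_trans (leq_bigmax a)) ?leq_addr.
    by rewrite /= ltn_add2l; apply: rEP wb w'b.
- move=> c; rewrite big_sumType /= (count_glue inl c (lleg D) phiE phiC).
  under eq_bigr => b _ do rewrite (count_glue inl c (gout b) phiE phiC).
  under [X in _ + (_ + X)]eq_bigr => b _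
    do rewrite (count_glue inr c (gout b) phiE phiC).
  case pc: (phi (val c)) => [a|v].
  + rewrite [X in _ + (_ + X)]big1 ?addn0; last first.
      move=> b _; apply/eqP; rewrite -leqn0 leqNgt -has_count; apply/hasP.
      by case=> w wb; rewrite phiN ?(mono_out mE wb).
    by rewrite -[RHS](mD a).
  + have vE : v \notin lleg E.
      apply/negP => vE; move: pc; case: (val c) => [//|u].
      have [/phiI[a ->] //|uE'] := boolP (u \in lleg E).
      by rewrite phiN // => -[uv]; rewrite uv vE in uE'.
    rewrite (eq_count (a2 := pred0)) ?count_pred0 //.
    rewrite [X in _ + (X + _)]big1 ?add0n; last first.
      by move=> b _; rewrite (eq_count (a2 := pred0)) ?count_pred0.
    rewrite -[RHS](mE v) (count_memPn vE) add0n; apply: eq_bigr => b _.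
    by apply: eq_in_count => w wb; rewrite phiN ?(mono_out mE wb).
Qed.

End Closure2.

(* Wirings are the diagrams without boxes: every wire is an input, and s lists *)
(* the wires that are output.                                                 *)
Section FreeMarkov.
Variable S : signature.
Implicit Types m n k w : seq (wire S).

Definition free_wiring m n (s : seq 'I_(size m))
    (sE : map (tnth (in_tuple m)) s = n) : diagram m n :=
  @Diagram S m n (cospan_wiring s) (map_wires m) sE
    (wiring_premarkov s) (@wiring_normal S m s).

Fact free_cast_cod m n (e : m = n) :
  map (tnth (in_tuple m)) (enum 'I_(size m)) = n.
Proof. by rewrite map_tnth_enum. Qed.

(* The identity on m, with codomain m or any n equal to it: the free Markov   *)
(* category is strict, and its coherence isomorphisms are such identities.    *)
Definition free_cast m n (e : m = n) : diagram m n :=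
  free_wiring (free_cast_cod e).

Definition free_id m : diagram m m := free_cast (erefl m).

Fact free_swap_cod m n :
  map (tnth (in_tuple (m ++ n))) (rot (size m) (enum 'I_(size (m ++ n))))
  = n ++ m.
Proof. by rewrite map_rot map_tnth_enum rot_size_cat. Qed.

Definition free_swap m n : diagram (m ++ n) (n ++ m) :=
  free_wiring (free_swap_cod m n).

Fact free_copy_cod m :
  map (tnth (in_tuple m)) (enum 'I_(size m) ++ enum 'I_(size m)) = m ++ m.
Proof. by rewrite map_cat map_tnth_enum. Qed.

Definition free_copy m : diagram m (m ++ m) := free_wiring (free_copy_cod m).

Definition free_del m : diagram m [::] := @free_wiring m [::] [::] erefl.

Fact free_tensor_leg m m' (A B : lgraph S) (s : seq (gwire A)) (t : seq (gwire B)) :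
    map wlab s = m -> map wlab t = m' ->
  map (@wlab S (coproduct A B)) (map inl s ++ map inr t) = m ++ m'.
Proof. by move=> <- <-; rewrite map_cat -!map_comp. Qed.

Definition free_tensor m n m' n' (f : diagram m n) (g : diagram m' n')
  : diagram (m ++ m') (n ++ n') :=
  @Diagram S _ _ (cospan_tensor f g)
    (free_tensor_leg (dgm_dom f) (dgm_dom g))
    (free_tensor_leg (dgm_cod f) (dgm_cod g))
    (tensor_premarkov (dgm_pre f) (dgm_pre g))
    (tensor_normal (@dgm_normal _ _ _ f) (@dgm_normal _ _ _ g)).

Section Comp.
Variables (m n k : seq (wire S)) (g : diagram n k) (f : diagram m n).

Fact free_comp_pre : premarkov (cospan_precomp g f).
Proof.
apply: precomp_premarkov; last exact: dgm_pre; last exact: dgm_pre.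
by rewrite dgm_cod dgm_dom.
Qed.

Fact free_comp_dom : map wlab (lleg (normalize (cospan_precomp g f))) = m.
Proof.
have [-> _] := normalize_legs free_comp_pre; rewrite -[RHS](dgm_dom f).
rewrite /= -map_comp; apply: eq_map => w /=; apply: pushout_wlab.
by rewrite dgm_cod dgm_dom.
Qed.

Fact free_comp_cod : map wlab (rleg (normalize (cospan_precomp g f))) = k.
Proof.
have [_ ->] := normalize_legs free_comp_pre; rewrite -[RHS](dgm_cod g).
rewrite /= -map_comp; apply: eq_map => w /=; apply: pushout_wlab.
by rewrite dgm_cod dgm_dom.
Qed.

(* g after f *)
Definition free_comp : diagram m k :=
  @Diagram S m k (normalize (cospan_precomp g f)) free_comp_dom free_comp_cod
    (normalize_premarkov free_comp_pre) (normalize_normal free_comp_pre).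

End Comp.

(* The two sides have the codomains [::] ++ w and w ++ [::], but [cospan_iso]  *)
(* compares the underlying cospans and needs no transport.                    *)
Definition free_non_signalling x w' y w (f : diagram (x ++ w') (y ++ w)) : Prop :=
  exists fs : diagram x w,
    cospan_iso (free_comp (free_tensor (free_del y) (free_id w)) f)
               (free_tensor fs (free_del w')).

Section Contraction.
Variables (m n w : seq (wire S)) (f : diagram (m ++ w) (n ++ w)).

Let i := take (size m) (lleg f).
Let i' := drop (size m) (lleg f).
Let j := take (size n) (rleg f).
Let j' := drop (size n) (rleg f).

Let map_i : map wlab i = m.
Proof. by rewrite map_take dgm_dom take_size_cat. Qed.
Let map_i' : map wlab i' = w.
Proof. by rewrite map_drop dgm_dom drop_size_cat. Qed.
Let map_j : map wlab j = n.
Proof. by rewrite map_take dgm_cod take_size_cat. Qed.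
Let map_j' : map wlab j' = w.
Proof. by rewrite map_drop dgm_cod drop_size_cat. Qed.

Let size_i' : size i' = size w.
Proof. by have := congr1 size map_i'; rewrite size_map. Qed.
Let size_j' : size j' = size w.
Proof. by have := congr1 size map_j'; rewrite size_map. Qed.
Let size_i : size i = size m.
Proof. by have := congr1 size map_i; rewrite size_map. Qed.
Let size_j : size j = size n.
Proof. by have := congr1 size map_j; rewrite size_map. Qed.
Let lleg_cat : lleg f = i ++ i'.
Proof. by rewrite cat_take_drop. Qed.
Let rleg_cat : rleg f = j ++ j'.
Proof. by rewrite cat_take_drop. Qed.

Hypothesis nsf : free_non_signalling f.

Lemma non_signalling_connect a c :
  a \in drop (size m) (lleg f) -> c \in drop (size n) (rleg f) ->
  ~~ connect (hstep f) a c.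
Proof.
move=> /onthP[k ka] /onthP[l lc]; apply/negP => ac.
have lw : l < size w by rewrite -size_j' -onthTE [onth _ _]lc.
have [fs isof] := nsf.
suff: io_connected (free_tensor fs (free_del w)) (size m + k) l.
  case=> x [y [/= kx ly /connectP[p]]].
  have [x' ->] : exists x', x = inr x'.
    have sfs : size (lleg fs) = size m by rewrite -(size_map wlab) dgm_dom.
    move: kx; rewrite onth_cat size_map sfs ltnNge leq_addr /= onth_map.
    by case: (onth _ _) => // x' [<-]; exists x'.
  have [y' ->] : exists y', y = inl y'.
    by move: ly; rewrite cats0 onth_map; case: (onth _ _) => // y' [<-]; exists y'.
  elim: p x' => [|z p IHp] x' //= /andP[/existsP[[b|[]] /andP[]]].
  by case/mapP.
apply: (iso_io isof); apply: normalize_io; first exact: free_comp_pre.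
set g := free_tensor _ _.
exists (glue (rleg f) (lleg g) (inl a)), (glue (rleg f) (lleg g) (inl c)).
split.
- by rewrite /= onth_map lleg_cat onth_cat size_i ltnNge leq_addr /= addKn ka.
- rewrite /= onth_map onth_map (onth_enum_ord (Ordinal lw)) /=; congr Some.
  apply/esym/glue_eqP; apply: glue_step; apply: (@onth_zip _ _ _ _ _ _ (size n + l)).
    by rewrite rleg_cat onth_cat size_j ltnNge leq_addr /= addKn.
  rewrite /= onth_cat size_map size_enum_ord ltnNge leq_addr /= addKn onth_map.
  by rewrite (onth_enum_ord (Ordinal lw)).
- exact: pushout_connect.
Qed.

Let s := i' ++ j'.
Let t := wires w ++ wires w.

Let labE : map wlab s = map (@wlab S (discrete w)) t.
Proof. by rewrite !map_cat map_i' map_j' map_wires. Qed.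

Fact free_contr_pre : premarkov (cospan_precontr (size m) (size n) w f).
Proof.
have [oF af mf] := dgm_pre f.
have := mono_uniq mf; rewrite lleg_cat cat_uniq => /and3P[_ /hasPn ii' ui'].
have ij' c : c \in j' -> c \notin i'.
  move=> cj; apply/negP => ci.
  by have := non_signalling_connect ci cj; rewrite connect0.
pose h x := if onth j' (index x i') is Some c then c else x.
have hN x : x \notin i' -> h x = x.
  by move=> xi; rewrite /h memNindex // onth_default // size_i' size_j'.
have hI x : x \in i' -> h x \in j'.
  rewrite -index_mem size_i' -size_j' -onthTE /h => Hx.
  by move: Hx; case jc: (onth _ _) => [c|] // _; apply: onth_mem jc.
have hNi x : h x \notin i'.
  have [/hI/ij' //|xi] := boolP (x \in i'); first by rewrite hN.
pose phi (x : gwire f + 'I_(size w)) : gwire f + 'I_(size w) := match x with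
  | inl x => inl (h x)
  | inr k => if onth j' k is Some c then inl c else inr k end.
have zipE a (k : 'I_(size w)) : ((a, k) \in zip s t) =
    (onth i' k == Some a) || (onth j' k == Some a).
  rewrite zip_cat ?size_i' ?size_enum_ord // mem_cat.
  suff H (l : seq (gwire f)) : ((a, k) \in zip l (wires w)) = (onth l k == Some a).
    by rewrite !H.
  apply/idP/eqP => [/zip_onth[k' [lk']]|lk]; last first.
    exact: (onth_zip lk (onth_enum_ord k)).
  by move/(index_onth (enum_uniq _)); rewrite index_enum_ord => ->.
have phiE a (b : 'I_(size w)) : (a, b) \in zip s t -> phi (inl a) = phi (inr b).
  rewrite zipE => /orP[/eqP ia|/eqP ja] /=; last first.
    by rewrite ja hN // ij' // (onth_mem ja).
  rewrite /h (index_onth ui' ia).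
  have: b < size j' by rewrite size_j'.
  by rewrite -onthTE; case: (onth _ _).
have phiC x : connect (glue_rel s t) x (phi x).
  case: x => [x|k] /=; last first.
    case jc: (onth _ _) => [c|] //.
    by rewrite glue_sym; apply: glue_step; rewrite zipE jc eqxx orbT.
  have [xi|/hN->//] := boolP (x \in i'); rewrite /h.
  case jc: (onth _ _) => [c|] //.
  have kw : index x i' < size w by rewrite -size_i' index_mem.
  apply: (@connect_trans _ _ (inr (Ordinal kw))).
    by apply: glue_step; rewrite zipE /= onth_index ?eqxx.
  by rewrite glue_sym; apply: glue_step; rewrite zipE /= jc eqxx orbT.
split.
- by apply: pushout_over => // -[].
- have [r rP] := acyclic_rank af.
  pose U x := [exists a, (a \in i') && connect (hstep f) a x].
  pose R x := (if U x then (\max_a r a).+1 else 0) + r x.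
  have Uj c : c \in j' -> U c = false.
    move=> cj; apply/existsP=> -[a /andP[ai ac]].
    by have := non_signalling_connect ai cj; rewrite ac.
  have Rlt b x y : x \in gin b -> y \in gout b -> R (h x) < R (h y).
    move=> xb yb; have exy : hstep f x y by apply/existsP; exists b; rewrite xb.
    have yi : y \notin i'.
      by apply: contra (mono_out mf yb) => yi; rewrite lleg_cat mem_cat yi orbT.
    rewrite (hN y yi); have [xi|xi] := boolP (x \in i').
      have Uy : U y by apply/existsP; exists x; rewrite xi connect1.
      rewrite /R Uj ?hI // Uy add0n addSn ltnS.
      by rewrite (leq_trans (leq_bigmax (h x))) ?leq_addr.
    rewrite hN // /R; have rxy := rP _ _ _ xb yb.
    have [/existsP[a /andP[ai ax]]|_] := boolP (U x).
      have -> : U y.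
        by apply/existsP; exists a; rewrite ai (connect_trans ax) ?connect1.
      by rewrite ltn_add2l.
    by rewrite add0n (leq_trans rxy) ?leq_addl.
  pose F x := match phi x with inl x => R x | inr _ => 0 end.
  apply: (@pushout_acyclic S f (discrete w) s t F).
  + by move=> a b /phiE; rewrite /F => ->.
  + exact: Rlt.
  + by case.
- move=> c; rewrite big_sumType /= [X in _ + (_ + X)]big_pred0 ?addn0; last by case.
  rewrite (count_glue inl c _ phiE phiC).
  under eq_bigr => b _ do rewrite (count_glue inl c (gout b) phiE phiC).
  have [z zi ->] : exists2 z, z \notin i' & phi (val c) = inl z.
    case: (val c) => [x|k]; first by exists (h x).
    have: k < size j' by rewrite size_j'.
    rewrite -onthTE /phi; case jc: (onth _ _) => [x|] // _.
    by exists x; rewrite // ij' // (onth_mem jc).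
  rewrite -[RHS](mf z) [in RHS]lleg_cat count_cat (count_memPn zi) addn0.
  congr (_ + _).
    by apply: eq_in_count => x xi; rewrite /phi hN //; apply/negP => /ii'/negP[].
  apply: eq_bigr => b _; apply: eq_in_count => x xb; rewrite /phi hN //.
  by apply: contra (mono_out mf xb) => xi; rewrite lleg_cat mem_cat xi orbT.
Qed.

Fact free_contr_dom :
  map wlab (lleg (normalize (cospan_precontr (size m) (size n) w f))) = m.
Proof.
have [-> _] := normalize_legs free_contr_pre; rewrite -[RHS]map_i.
by rewrite /= -map_comp; apply: eq_map => x; apply: (pushout_wlab labE).
Qed.

Fact free_contr_cod :
  map wlab (rleg (normalize (cospan_precontr (size m) (size n) w f))) = n.
Proof.
have [_ ->] := normalize_legs free_contr_pre; rewrite -[RHS]map_j.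
by rewrite /= -map_comp; apply: eq_map => x; apply: (pushout_wlab labE).
Qed.

Definition free_contr : diagram m n :=
  @Diagram S m n (normalize (cospan_precontr (size m) (size n) w f))
    free_contr_dom free_contr_cod
    (normalize_premarkov free_contr_pre) (normalize_normal free_contr_pre).

End Contraction.

End FreeMarkov.

(* A strong symmetric monoidal functor from the free Markov category on S to  *)
(* C preserving copy and delete; [imap_iso] expresses that it is defined on   *)
(* isomorphism classes of cospans.                                            *)
Record markov_functor (S : signature) (C : markov) := MarkovFunctor {
  iob : seq (wire S) -> C;
  imap : forall m n : seq (wire S), diagram m n -> hom (iob m) (iob n);
  imap_iso : forall m n (f g : diagram m n),
    cospan_iso f g -> imap f = imap g;
  imap_id : forall m, imap (free_id m) = idm (iob m);
  imap_comp : forall m n k (g : diagram n k) (f : diagram m n),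
    imap (free_comp g f) = imap g ∘ imap f;
  mu : forall m n, hom (iob m ⊗ iob n) (iob (m ++ n));
  muV : forall m n, hom (iob (m ++ n)) (iob m ⊗ iob n);
  eta : hom munit (iob [::]);
  etaV : hom (iob [::]) munit;
  mu_iso : forall m n, mutually_inverse (mu m n) (muV m n);
  eta_iso : mutually_inverse eta etaV;
  mu_nat : forall m n m' n' (f : diagram m n) (g : diagram m' n'),
    imap (free_tensor f g) ∘ mu m m' = mu n n' ∘ (imap f ⊠ imap g);
  mu_assoc : forall m n k,
    imap (free_cast (esym (catA m n k))) ∘ mu (m ++ n) k ∘ (mu m n ⊠ idm (iob k))
    = mu m (n ++ k) ∘ (idm (iob m) ⊠ mu n k) ∘ assoc (iob m) (iob n) (iob k);
  mu_lunit : forall m,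
    imap (free_cast (cat0s m)) ∘ mu [::] m ∘ (eta ⊠ idm (iob m)) = lun (iob m);
  mu_runit : forall m,
    imap (free_cast (cats0 m)) ∘ mu m [::] ∘ (idm (iob m) ⊠ eta) = run (iob m);
  mu_swap : forall m n,
    imap (free_swap m n) ∘ mu m n = mu n m ∘ swap (iob m) (iob n);
  imap_copy : forall m, imap (free_copy m) = mu m m ∘ copy (iob m);
  imap_del : forall m, imap (free_del m) = eta ∘ del (iob m) }.

Arguments imap {S C} _ {m n} f.

Definition satisfies_contraction_identities (C : markov) : Prop :=
  forall (S : signature) (m n w : seq (wire S))
      (C1 C2 : diagram (m ++ w) (n ++ w))
      (ns1 : free_non_signalling C1) (ns2 : free_non_signalling C2)
      (F : markov_functor S C),
    imap F C1 = imap F C2 ->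
    imap F (free_contr ns1) = imap F (free_contr ns2).

(* Main.v *)
From mathcomp Require Import all_boot.
Require Import Defs.

(* A non-signalling diagram f : m + w -> n + w splits along the boxes from    *)
(* which some output of the second block w can be reached.  They form a       *)
(* diagram h : m -> w + z, where z lists all the wires produced so far, and   *)
(* the other boxes form a diagram k : z + w -> n; then f runs h, outputs its  *)
(* w, and feeds z and the second input of f to k, while contr(f) feeds k with *)
(* both results of h.                                                         *)
(* In C, let c be a conditional of h on W and let p : M -> W * M be the graph *)
(* of the W-marginal of h.  Then contr(f) is                                  *)
(* g := ((w, x), (w', x')) |-> k(c(w, x), w') precomposed with copy o p,      *)
(* whereas precomposing g with p * p (and remembering the argument) gives a   *)
(* morphism which only depends on f, because the marginal of h does so by     *)
(* cancellativity.  Atomicity of p goes from the latter to the former.        *)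

Set Implicit Arguments.
Unset Strict Implicit.
Unset Printing Implicit Defensive.

Local Open Scope markov_scope.

(** * Pairing in Markov categories *)

(** The categorical half is [contract_plug]. Draw (w, x) and (w', x') from two independent copies of
    the graph p of the marginal of h, and run k on c(w, x) and w'. By [plug_graph] this amounts to
    running f on x and w' and remembering the arguments, so f and p determine it. The contraction is
    the case where both samples coincide: there [conditional_graph] reassembles h from p and c.
    Atomicity says precisely that equalities pass from independent samples to a copied one.

    The diagrammatic half is [factor_iso] and [contr_iso], which write f and its contraction with
    the same h and k. Non-signalling says that no wire of the second input reaches the second
    output, so everything the second output needs can run before that input arrives. Composites are
    normalized, and [core_unique] controls this: a normal form keeps exactly the boxes from which an
    output can be reached. [imap_factor] and [imap_contr] transport both isomorphisms to C. *)

Section Kelly.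
Variable C : symmonoidal.
Implicit Types X Y Z : C.

Lemma iso_monic (X Y Z : C) (f : hom Y Z) g (a b : hom X Y) :
  mutually_inverse f g -> f ∘ a = f ∘ b -> a = b.
Proof. by case=> gf _ e; rewrite -[a]comp1m -[b]comp1m -gf -!compA e. Qed.

Lemma iso_epic (X Y Z : C) (f : hom X Y) g (a b : hom Y Z) :
  mutually_inverse f g -> a ∘ f = b ∘ f -> a = b.
Proof. by case=> _ fg e; rewrite -[a]compm1 -[b]compm1 -fg !compA e. Qed.

Lemma tens_compl X X' X'' Y (f : hom X' X'') (g : hom X X') :
  (f ∘ g) ⊠ idm Y = (f ⊠ idm Y) ∘ (g ⊠ idm Y).
Proof. by rewrite -tens_comp comp1m. Qed.

Lemma tens_compr X X' X'' Y (f : hom X' X'') (g : hom X X') :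
  idm Y ⊠ (f ∘ g) = (idm Y ⊠ f) ∘ (idm Y ⊠ g).
Proof. by rewrite -tens_comp comp1m. Qed.

Lemma run_faithful X Y (f g : hom X Y) :
  f ⊠ idm munit = g ⊠ idm munit -> f = g.
Proof.
by move=> e; apply: (iso_epic (run_iso X)); rewrite -!run_nat e.
Qed.

Lemma lun_faithful X Y (f g : hom X Y) :
  idm munit ⊠ f = idm munit ⊠ g -> f = g.
Proof.
by move=> e; apply: (iso_epic (lun_iso X)); rewrite -!lun_nat e.
Qed.

(** Kelly's argument: tensoring with the unit is faithful and [assoc] is invertible, so the equation
    may be checked after both, where it follows from the pentagon and the triangle. *)
Lemma run_tens X Y : (idm X ⊠ run Y) ∘ assoc X Y munit = run (X ⊗ Y).
Proof.
apply: run_faithful; apply: (iso_monic (assoc_iso X Y munit)).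
rewrite tens_compl compA assoc_nat -triangle [in LHS]tens_compr -!compA.
rewrite (compA (idm X ⊠ assoc _ _ _)) -pentagon compA -assoc_nat tens_id -compA triangle.
by [].
Qed.

Lemma assocK X Y Z : assocV X Y Z ∘ assoc X Y Z = idm _.
Proof. by case: (assoc_iso X Y Z). Qed.

Lemma assocVK X Y Z : assoc X Y Z ∘ assocV X Y Z = idm _.
Proof. by case: (assoc_iso X Y Z). Qed.

Lemma lun_tens X Y : lun (X ⊗ Y) ∘ assoc munit X Y = lun X ⊠ idm Y.
Proof.
apply: lun_faithful.
have i1 := assoc_iso munit (munit ⊗ X) Y.
have i2 : mutually_inverse (assoc munit munit X ⊠ idm Y) (assocV munit munit X ⊠ idm Y).
  by split; rewrite -tens_comp comp1m ?assocK ?assocVK tens_id.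
apply: (iso_epic i1); apply: (iso_epic i2).
rewrite tens_compr -!compA.
rewrite (compA (idm munit ⊠ assoc _ _ _)) -pentagon compA triangle.
rewrite -[idm (_ ⊗ _)]tens_id.
by rewrite -assoc_nat -triangle tens_compl compA assoc_nat -compA.
Qed.
End Kelly.

(** * Tupling and projections when copying is not natural *)

Section Pairing.
Variable C : markov.
Implicit Types A X Y Z T : C.

Lemma to_munit X (f g : hom X munit) : f = g.
Proof.
by rewrite -[f]comp1m -[g]comp1m -(del_unit C) !del_nat.
Qed.

Lemma to_munit2 X (f g : hom X (munit ⊗ munit)) : f = g.
Proof. by apply: (iso_monic (lun_iso munit)); apply: to_munit. Qed.

(* Locked, as are the projections: otherwise rewriting with compA unfolds    *)
(* them to reach the composite inside.                                        *)
Definition pairing A X Y (f : hom A X) (g : hom A Y) : hom A (X ⊗ Y) :=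
  locked ((f ⊠ g) ∘ copy A).

Definition pfst X Y : hom (X ⊗ Y) X := locked (run X ∘ (idm X ⊠ del Y)).
Definition psnd X Y : hom (X ⊗ Y) Y := locked (lun Y ∘ (del X ⊠ idm Y)).

Lemma pairingE A X Y (f : hom A X) (g : hom A Y) : pairing f g = (f ⊠ g) ∘ copy A.
Proof. by rewrite /pairing -lock. Qed.

Lemma pfstE X Y : pfst X Y = run X ∘ (idm X ⊠ del Y).
Proof. by rewrite /pfst -lock. Qed.

Lemma psndE X Y : psnd X Y = lun Y ∘ (del X ⊠ idm Y).
Proof. by rewrite /psnd -lock. Qed.

Definition deterministic X Y (f : hom X Y) : Prop := copy Y ∘ f = pairing f f.

Lemma tens_pair A X Y X' Y' (f : hom X X') (g : hom Y Y') (a : hom A X) (b : hom A Y) :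
  (f ⊠ g) ∘ pairing a b = pairing (f ∘ a) (g ∘ b).
Proof. by rewrite !pairingE compA tens_comp. Qed.

Lemma pair_idm X : pairing (idm X) (idm X) = copy X.
Proof. by rewrite pairingE tens_id comp1m. Qed.

Lemma fst_pair A X Y (a : hom A X) (b : hom A Y) : pfst X Y ∘ pairing a b = a.
Proof.
rewrite pfstE -compA tens_pair comp1m del_nat.
have -> : pairing a (del A) = (a ⊠ idm munit) ∘ ((idm A ⊠ del A) ∘ copy A).
  by rewrite pairingE compA -tens_comp compm1 comp1m.
by rewrite compA run_nat -compA (compA (run A)) copy_rcounit compm1.
Qed.

Lemma snd_pair A X Y (a : hom A X) (b : hom A Y) : psnd X Y ∘ pairing a b = b.
Proof.
rewrite psndE -compA tens_pair comp1m del_nat.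
have -> : pairing (del A) b = (idm munit ⊠ b) ∘ ((del A ⊠ idm A) ∘ copy A).
  by rewrite pairingE compA -tens_comp compm1 comp1m.
by rewrite compA lun_nat -compA (compA (lun A)) copy_lcounit compm1.
Qed.

Lemma swap_pair A X Y (a : hom A X) (b : hom A Y) : swap X Y ∘ pairing a b = pairing b a.
Proof. by rewrite !pairingE compA swap_nat -compA copy_comm. Qed.

Lemma assoc_pair A X Y Z (a : hom A X) (b : hom A Y) (c : hom A Z) :
  assoc X Y Z ∘ pairing (pairing a b) c = pairing a (pairing b c).
Proof.
rewrite !pairingE -{1}[c]compm1 tens_comp !compA assoc_nat -!compA [X in _ ∘ X]compA.
by rewrite copy_coassoc compA -tens_comp compm1.
Qed.

Lemma assocV_pair A X Y Z (a : hom A X) (b : hom A Y) (c : hom A Z) :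
  assocV X Y Z ∘ pairing a (pairing b c) = pairing (pairing a b) c.
Proof. by rewrite -assoc_pair compA assocK comp1m. Qed.

Lemma midswap_nat X X' Y Y' Z Z' T T' (a : hom X X') (b : hom Y Y') (c : hom Z Z')
    (d : hom T T') :
  midswap X' Y' Z' T' ∘ ((a ⊠ b) ⊠ (c ⊠ d)) = ((a ⊠ c) ⊠ (b ⊠ d)) ∘ midswap X Y Z T.
Proof.
have assocV_nat X1 X1' Y1 Y1' Z1 Z1' (f : hom X1 X1') (g : hom Y1 Y1') (h : hom Z1 Z1') :
    assocV X1' Y1' Z1' ∘ (f ⊠ (g ⊠ h)) = ((f ⊠ g) ⊠ h) ∘ assocV X1 Y1 Z1 :> hom _ (_ : C).
  apply: (iso_monic (assoc_iso _ _ _)).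
  by rewrite compA assocVK comp1m compA assoc_nat -compA assocVK compm1.
rewrite /midswap -!compA assoc_nat; rewrite [X in _ ∘ X = _]compA -tens_comp comp1m.
rewrite -!compA assocV_nat; rewrite (compA (swap _ _ ⊠ _)) -tens_comp swap_nat comp1m.
rewrite -{1}[d]compm1 tens_comp -(compA (_ ⊠ d)) (compA (assoc _ _ _)) assoc_nat.
by rewrite -compA -{1}[a]compm1 tens_comp !compA assocV_nat -!compA.
Qed.

Lemma pair_tensl A B X Y Z T (a : hom A X) (b : hom A Y) (c : hom B Z) (d : hom B T) :
  pairing (a ⊠ c) (b ⊠ d) = midswap X Y Z T ∘ (pairing a b ⊠ pairing c d).
Proof. by rewrite !pairingE copy_tens compA -midswap_nat -compA tens_comp. Qed.


Lemma run_pair A X (a : hom A X) (b : hom A munit) : run X ∘ pairing a b = a.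
Proof. by rewrite -[RHS](fst_pair a b) pfstE del_unit tens_id compm1. Qed.

Lemma lun_pair A X (a : hom A munit) (b : hom A X) : lun X ∘ pairing a b = b.
Proof. by rewrite -[RHS](snd_pair a b) psndE del_unit tens_id compm1. Qed.

Lemma fst_snd X Y : pairing (pfst X Y) (psnd X Y) = idm (X ⊗ Y).
Proof.
rewrite pfstE psndE -tens_pair pair_tensl.
(* Only two units are exchanged, and [munit ⊗ munit] is terminal. *)
have -> : midswap X munit munit Y = idm _.
  rewrite /midswap (to_munit2 (swap _ _) (idm _)) tens_id compm1 assocVK tens_id.
  by rewrite compm1 assocK.
by rewrite comp1m -tens_comp run_pair lun_pair tens_id.
Qed.

(** Reduces tensors to tuples, so that most wiring identities below become computations with
    components. *)
Lemma tensE X X' Y Y' (f : hom X X') (g : hom Y Y') :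
  f ⊠ g = pairing (f ∘ pfst X Y) (g ∘ psnd X Y).
Proof. by rewrite -tens_pair fst_snd compm1. Qed.

Lemma fst_munit X : pfst X munit = run X.
Proof. by rewrite pfstE del_unit tens_id compm1. Qed.

Lemma snd_munit X : psnd munit X = lun X.
Proof. by rewrite psndE del_unit tens_id compm1. Qed.

Lemma lun_swap X : lun X ∘ swap X munit = run X.
Proof.
by rewrite -[swap _ _]compm1 -fst_snd swap_pair lun_pair fst_munit.
Qed.

Lemma run_swap X : run X ∘ swap munit X = lun X.
Proof. by rewrite -lun_swap -compA swap_swap compm1. Qed.

Lemma assocV_triangle X Y : (run X ⊠ idm Y) ∘ assocV X munit Y = idm X ⊠ lun Y.
Proof. by rewrite -triangle -compA assocVK compm1. Qed.

Lemma lun_assocV X Y : (lun X ⊠ idm Y) ∘ assocV munit X Y = lun (X ⊗ Y).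
Proof. by rewrite -lun_tens -compA assocVK compm1. Qed.

Lemma run_midswap X Y :
  (run X ⊠ run Y) ∘ midswap X Y munit munit = run (X ⊗ Y) ∘ (idm _ ⊠ lun munit).
Proof.
rewrite -[run X in LHS]comp1m -[run Y in LHS]compm1 tens_comp /midswap -!compA.
rewrite (compA (run X ⊠ _)) assocV_triangle compA -tens_comp comp1m compA -tens_comp comp1m.
rewrite -!compA (compA (lun _)) lun_tens (compA (_ ⊠ _)) -tens_comp lun_swap comp1m.
by rewrite assocV_triangle -run_tens -[RHS]compA -tens_id assoc_nat [RHS]compA -tens_compr.
Qed.

Lemma lun_midswap X Y :
  (lun X ⊠ lun Y) ∘ midswap munit munit X Y = lun (X ⊗ Y) ∘ (lun munit ⊠ idm _).
Proof.
rewrite -[lun X in LHS]comp1m -[lun Y in LHS]compm1 tens_comp /midswap -!compA.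
rewrite (compA (lun X ⊠ _)) lun_assocV (compA (lun _)) lun_nat -!compA.
rewrite (compA (_ ⊠ lun Y)) triangle (compA (run X ⊠ _)) -tens_comp run_swap comp1m.
by rewrite (compA (lun X ⊠ _)) lun_assocV lun_tens.
Qed.

Lemma fst_det X Y : deterministic (pfst X Y).
Proof.
rewrite /deterministic pfstE -tens_pair pair_tensl [RHS]compA run_midswap.
rewrite pair_idm -[RHS]compA -tens_comp comp1m lun_pair compA -run_nat -compA -tens_comp.
by rewrite comp1m compm1.
Qed.

Lemma snd_det X Y : deterministic (psnd X Y).
Proof.
rewrite /deterministic psndE -tens_pair pair_tensl [RHS]compA lun_midswap.
rewrite pair_idm -[RHS]compA -tens_comp comp1m lun_pair compA -lun_nat -compA -tens_comp.
by rewrite comp1m compm1.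
Qed.

(** Stands in for naturality of [copy]; it will be applied to projections, which are deterministic
    by [fst_det] and [snd_det]. *)
Lemma pair_det A B X Y (f : hom B X) (g : hom B Y) (d : hom A B) :
  deterministic d -> pairing f g ∘ d = pairing (f ∘ d) (g ∘ d).
Proof. by move=> dd; rewrite -tens_pair -dd compA -pairingE. Qed.

End Pairing.

(** * Graphs of marginals and conditionals *)

Section Projections.
Variable C : markov.
Implicit Types A M N W X Y Z : C.

Lemma fst_tens X X' Y Y' (f : hom X X') (g : hom Y Y') :
  pfst X' Y' ∘ (f ⊠ g) = f ∘ pfst X Y.
Proof. by rewrite tensE fst_pair. Qed.

Lemma fst_swap X Y : pfst Y X ∘ swap X Y = psnd X Y.
Proof. by rewrite -[swap _ _]compm1 -fst_snd swap_pair fst_pair. Qed.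

Lemma fst_assoc X Y Z : pfst X (Y ⊗ Z) ∘ assoc X Y Z = pfst X Y ∘ pfst (X ⊗ Y) Z.
Proof.
rewrite -[assoc _ _ _]compm1 -fst_snd -[pfst (X ⊗ Y) Z in LHS]comp1m -fst_snd.
by rewrite (pair_det _ _ (fst_det _ _)) assoc_pair fst_pair.
Qed.

Lemma assocV_copy X Y : assocV X Y Y ∘ (idm X ⊠ copy Y) = pairing (idm _) (psnd X Y).
Proof. by rewrite tensE comp1m snd_det assocV_pair fst_snd. Qed.

Lemma pair_fst_idm X Y : pairing (pfst X Y) (idm _) = assoc X X Y ∘ (copy X ⊠ idm Y).
Proof. by rewrite tensE comp1m fst_det assoc_pair fst_snd. Qed.

(** With the unit as parameter object, almost sure equality compares the maps while their argument
    is remembered. *)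
Lemma as_equalE A X Y (q : hom A X) (g1 g2 : hom X Y) :
  as_equal q (g1 ∘ lun X) (g2 ∘ lun X) <-> pairing g1 (idm X) ∘ q = pairing g2 (idm X) ∘ q.
Proof.
have E g : ((g ∘ lun X) ⊠ idm X) ∘ assocV munit X X ∘ (idm munit ⊠ (copy X ∘ q)) =
    pairing g (idm X) ∘ q ∘ lun A :> hom _ (Y ⊗ X).
  rewrite tens_compr compA -(compA _ (assocV _ _ _)) assocV_copy snd_munit.
  rewrite tens_pair compm1 -pair_det; last by rewrite -snd_munit; apply: snd_det.
  by rewrite -!compA lun_nat.
rewrite /as_equal !E; split=> [|-> //].
exact: (iso_epic (lun_iso A)).
Qed.

(** Although p need not be deterministic, its M-component is a copy of its input, so copying that
    component after p or before p is the same by coassociativity. *)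
Lemma graph_snd M W (m : hom M W) (p := pairing m (idm M)) :
  pairing (idm _) (psnd W M) ∘ p = pairing p (idm M).
Proof.
by rewrite -assocV_copy -compA tens_pair comp1m compm1 -pair_idm assocV_pair.
Qed.

Lemma graph_tens_snd M W X (m : hom M W) (p := pairing m (idm M)) :
  pairing (idm _) (psnd W M ⊠ idm X) ∘ (p ⊠ idm X) = pairing (p ⊠ idm X) (idm (M ⊗ X)).
Proof.
rewrite -tens_id pair_tensl -compA -tens_comp graph_snd compm1.
by rewrite -pair_tensl tens_id.
Qed.

Lemma conditional_graph M W Z (h : hom M (W ⊗ Z)) c : is_conditional h c ->
  h = pairing (pfst W M) c ∘ pairing (marginal h) (idm M).
Proof.
move=> hc; rewrite {1}hc -(compA _ (assoc _ _ _)) -pair_fst_idm tens_pair comp1m.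
by rewrite compm1 -compA -pairingE.
Qed.

Lemma marginalE A X Y (f : hom A (X ⊗ Y)) : marginal f = pfst X Y ∘ f.
Proof. by rewrite pfstE. Qed.

(** Discarding the output of k discards k, so the W-output ignores the second input. With
    [cancel_fst], the plugged composite thus determines the marginal of h. *)
Lemma marginal_plug M N W Z (h : hom M (W ⊗ Z)) (k : hom (Z ⊗ W) N) :
  pfst W N ∘ ((idm W ⊠ k) ∘ assoc W Z W ∘ (h ⊠ idm W)) = pfst W Z ∘ h ∘ pfst M W.
Proof.
by rewrite !compA fst_tens comp1m fst_assoc -!compA fst_tens compA.
Qed.

(** On tuples: ((w, n), (x, y)) goes to (n, ((w, x), y)). *)
Definition reshuffle (W N M X : C) : hom ((W ⊗ N) ⊗ (M ⊗ X)) (N ⊗ ((W ⊗ M) ⊗ X)) :=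
  locked ((idm N ⊠ assocV W M X) ∘ assoc N W (M ⊗ X) ∘ (swap W N ⊠ idm _)).

Lemma reshuffle_pair A (W N M X : C) (a : hom A W) (b : hom A N) (c : hom A M) (d : hom A X) :
  reshuffle W N M X ∘ pairing (pairing a b) (pairing c d) = pairing b (pairing (pairing a c) d).
Proof.
by rewrite /reshuffle -lock -!compA tens_pair swap_pair assoc_pair tens_pair !comp1m assocV_pair.
Qed.

(** The first sample (w, x) is remembered, so w and c(w, x) together make up an output of h. On the
    right, h and k enter only through the plugged composite and through p, and the conditional c has
    disappeared. *)
Lemma plug_graph M N W Z (h : hom M (W ⊗ Z)) (k : hom (Z ⊗ W) N) c
    (p := pairing (marginal h) (idm M)) :
  is_conditional h c ->
  pairing (k ∘ (c ⊠ pfst W M)) (idm _) ∘ (p ⊠ p) =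
  reshuffle W N M (W ⊗ M)
  ∘ pairing ((idm W ⊠ k) ∘ assoc W Z W ∘ (h ⊠ idm W) ∘ (idm M ⊠ pfst W M)) (idm _)
  ∘ (idm M ⊠ p).
Proof.
move=> hc.
pose X := W ⊗ M.
pose a := (idm W ⊠ k) ∘ assoc W Z W ∘ (pairing (pfst W M) c ⊠ pfst W M).
(* [a] returns w along with the value of k, so adding x and the second sample restores the whole
   argument, up to order. *)
have -> : pairing (k ∘ (c ⊠ pfst W M)) (idm _) = reshuffle W N M X ∘ pairing a (psnd W M ⊠ idm X).
  rewrite /a [pairing _ _ ⊠ _]tensE -!compA (pair_det _ _ (fst_det _ _)) assoc_pair.
  rewrite tens_pair -tensE comp1m [_ ⊠ idm X]tensE reshuffle_pair.
  by rewrite -(pair_det _ _ (fst_det _ _)) fst_snd !comp1m fst_snd.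
have -> : pairing a (psnd W M ⊠ idm X) = (a ⊠ idm _) ∘ pairing (idm _) (psnd W M ⊠ idm X).
  by rewrite tens_pair compm1 comp1m.
have -> : p ⊠ p = (p ⊠ idm X) ∘ (idm M ⊠ p) by rewrite -tens_comp compm1 comp1m.
rewrite -!compA; congr (_ ∘ _); rewrite !compA; congr (_ ∘ _).
(* The remembered x may be taken from the input of p, which frees p to be merged with c into h. *)
rewrite -compA graph_tens_snd tens_pair comp1m /a -compA -tens_comp compm1.
rewrite -conditional_graph //.
by rewrite -!compA -tens_comp comp1m compm1.
Qed.

End Projections.

(** * The contraction identity in C *)

Section AtomicContraction.
Variable C : markov.
Hypotheses (canc : cancellative C) (atom : atomic C) (cond : has_conditionals C).

(** Up to a swap, composing with the projection carries the same information as tensoring with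
    [del W]. *)
Lemma cancel_fst (M W Y : C) (a b : hom M Y) : a ∘ pfst M W = b ∘ pfst M W -> a = b.
Proof.
move=> e; apply: (@canc W).
by rewrite !tensE -!fst_swap !compA e.
Qed.

Lemma contract_plug (M N W Z1 Z2 : C) (h1 : hom M (W ⊗ Z1)) (h2 : hom M (W ⊗ Z2))
    (k1 : hom (Z1 ⊗ W) N) (k2 : hom (Z2 ⊗ W) N) :
  (idm W ⊠ k1) ∘ assoc W Z1 W ∘ (h1 ⊠ idm W)
  = (idm W ⊠ k2) ∘ assoc W Z2 W ∘ (h2 ⊠ idm W) ->
  k1 ∘ swap W Z1 ∘ h1 = k2 ∘ swap W Z2 ∘ h2.
Proof.
move=> e; have [[c1 hc1] [c2 hc2]] := (cond h1, cond h2).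
have em : marginal h1 = marginal h2.
  by apply: (@cancel_fst M W); rewrite !marginalE -(marginal_plug _ k1) -(marginal_plug _ k2) e.
have pe : pairing (marginal h1) (idm M) = pairing (marginal h2) (idm M) by rewrite em.
set p := pairing (marginal h2) (idm M).
have eqp : as_equal (p ⊠ p) (k1 ∘ (c1 ⊠ pfst W M) ∘ lun _) (k2 ∘ (c2 ⊠ pfst W M) ∘ lun _).
  by apply/as_equalE; rewrite (plug_graph _ hc2) -e /p -pe; apply: plug_graph.
(* Atomicity replaces the two independent samples by one copied sample; [pfst] then forgets the
   remembered argument. *)
have /as_equalE/(congr1 (fun f => pfst _ _ ∘ f)) := atom eqp.
rewrite !(compA (pfst _ _)) !fst_pair -!compA !(compA _ (copy _) p) -!pairingE => ek.
rewrite (conditional_graph hc1) (conditional_graph hc2) pe.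
by rewrite !(compA (swap _ _)) !swap_pair.
Qed.

End AtomicContraction.

(** * Diagrams *)

Section NormalForm.
Variable S : signature.
Implicit Types A B D E : cospan S.

Definition cospan_embedding D E (fw : gwire D -> gwire E) (fb : gbox D -> gbox E) : Prop :=
  [/\ injective fw, injective fb,
      @is_hypergraph_hom (hypergraph_of D) (hypergraph_of E) fw fb,
      (forall w, wlab (fw w) = wlab w) /\ (forall b, blab (fb b) = blab b)
    & lleg E = map fw (lleg D) /\ rleg E = map fw (rleg D)].

Lemma embedding_comp A D E (fw : gwire A -> gwire D) fb (gw : gwire D -> gwire E) gb :
  cospan_embedding fw fb -> cospan_embedding gw gb ->
  cospan_embedding (gw \o fw) (gb \o fb).
Proof.
case=> fwi fbi fh [fwl fbl] [fll frl] [gwi gbi gh [gwl gbl] [gll grl]].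
split; try exact: inj_comp.
- move=> b; have [/= e1 e2] := fh b; have [/= d1 d2] := gh (fb b).
  by rewrite d1 d2 e1 e2 -!map_comp.
- by split=> x /=; rewrite ?gwl ?fwl ?gbl ?fbl.
- by rewrite gll grl fll frl -!map_comp.
Qed.

Lemma embedding_inv D E (fw : gwire D -> gwire E) fb gw gb :
    cancel fw gw -> cancel gw fw -> cancel fb gb -> cancel gb fb ->
  cospan_embedding fw fb -> cospan_embedding gw gb.
Proof.
move=> fwK gwK fbK gbK [_ _ fh [fwl fbl] [fll frl]].
split; [exact: can_inj gwK|exact: can_inj gbK| | |].
- move=> b; have [/= e1 e2] := fh (gb b); rewrite gbK in e1 e2.
  by rewrite e1 e2 !(mapK fwK).
- by split=> x; [rewrite -fwl gwK | rewrite -fbl gbK].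
- by rewrite fll frl !(mapK fwK).
Qed.

Definition needed D (b : gbox D) : Prop :=
  exists o c, [/\ o \in gout b, c \in rleg D & connect (hstep D) o c].

Lemma embedding_connect D E (fw : gwire D -> gwire E) fb x y :
  cospan_embedding fw fb -> connect (hstep D) x y -> connect (hstep E) (fw x) (fw y).
Proof.
case=> _ _ fh _ _ /connectP[p]; elim: p x => [|z p IHp] x /=; first by move=> _ ->.
case/andP=> /existsP[b /andP[xb zb]] pp ey.
apply: connect_trans (IHp _ pp ey); apply: connect1; apply/existsP.
by exists (fb b); have [/= -> ->] := fh b; rewrite !map_f.
Qed.

Lemma embedding_needed D E (fw : gwire D -> gwire E) (fb : gbox D -> gbox E) b :
  cospan_embedding fw fb -> needed b -> needed (fb b).
Proof.
move=> emb [x [y [xb yr xy]]]; exists (fw x), (fw y).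
have [_ _ fh _ [_ fr]] := emb; have [/= _ ->] := fh b; rewrite fr !map_f //.
by split=> //; apply: embedding_connect emb xy.
Qed.

Lemma eliminable_not_needed D (b : gbox D) : eliminable D b -> ~ needed b.
Proof.
move=> /allP elb [x [y [/elb/andP[xr /forallP xi] yr /connectP[[|z p] /=]]]].
  by move=> _ yx; rewrite yx (negPf xr) in yr.
by case/andP=> /existsP[c /andP[xc _]]; have := xi c; rewrite xc.
Qed.

(** A box that is not eliminable has an output wire that is a global output or feeds another box;
    following such wires must end at a global output by acyclicity. *)
Lemma normal_needed D : premarkov D -> normal D -> forall b : gbox D, needed b.
Proof.
move=> pD nD; have [r rP] := acyclic_rank (pm_acyclic pD).
have out b : exists2 w, w \in gout b & (w \in rleg D) || [exists b' : gbox D, w \in gin b'].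
  have /allPn[w wb] := nD b; rewrite negb_and negbK negb_forall => H.
  exists w => //; case/orP: H => [->//|/existsP[b' /negPn wb']].
  by apply/orP; right; apply/existsP; exists b'.
(* Induction on how far the rank of w is below the maximum, since passing through a box raises the
   rank. *)
have H k w : \max_x r x - r w <= k -> (w \in rleg D) || [exists b' : gbox D, w \in gin b'] ->
    exists2 c, c \in rleg D & connect (hstep D) w c.
  elim: k w => [|k IHk] w lek /orP[wr|/existsP[b wb]]; try by [exists w].
    have [w' w'b _] := out b; have := rP _ _ _ wb w'b.
    rewrite leqn0 subn_eq0 in lek; rewrite ltnNge (leq_trans _ lek) //.
    exact: (leq_bigmax w').
  have [w' w'b w'r] := out b; have lt := rP _ _ _ wb w'b.
  have [|c cr w'c] := IHk w' _ w'r.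
    rewrite leq_subLR (leq_trans _ (leq_add lt (leqnn k))) //.
    by rewrite addSnnS -leq_subLR.
  exists c => //; apply: connect_trans w'c; apply: connect1; apply/existsP.
  by exists b; rewrite wb.
move=> b; have [w wb wr] := out b; have [c cr wc] := H _ w (leqnn _) wr.
by exists w, c.
Qed.

(** E arises from D by dropping only boxes that reach no output, whatever the order of deletion.
    Asking that [b'] be needed in E itself makes the relation transitive. *)
Definition core D E : Prop :=
  exists (fw : gwire E -> gwire D) (fb : gbox E -> gbox D),
    cospan_embedding fw fb /\ forall b, needed b -> exists2 b', fb b' = b & needed b'.

Lemma core_refl D : core D D.
Proof.
exists id, id; split; last by move=> b nb; exists b.
by split=> //; [move=> b; rewrite !map_id | rewrite !map_id].
Qed.

Lemma core_trans D E A : core D E -> core E A -> core D A.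
Proof.
case=> fw [fb [fE fC]] [gw [gb [gE gC]]]; exists (fw \o gw), (fb \o gb).
split; first exact: embedding_comp.
by move=> b /fC[b' <- /gC[b'' <- nb]]; exists b''.
Qed.

Lemma delete_core D (b : gbox D) :
  left_monogamous D -> eliminable D b -> core D (delete_box b).
Proof.
move=> mD elb; exists val, val; split.
  split=> //; try exact: val_inj.
  - by move=> c; rewrite /= (delete_gin elb c) (delete_gout mD c).
  - by rewrite (delete_lleg b mD) (delete_rleg elb).
move=> c nc; have cb : c != b.
  by apply/eqP=> cb; apply: (eliminable_not_needed elb); rewrite -cb.
have [x [y [xc yr xy]]] := nc; exists (Sub c cb : gbox (delete_box b)) => //.
have eo := delete_gout mD (Sub c cb : gbox (delete_box b)); rewrite SubK in eo.
have := xc; rewrite -eo => /mapP[x' x'c ex].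
have := yr; rewrite -(delete_rleg elb) => /mapP[y' y'c ey].
exists x', y'; split=> //; apply: delete_connect => //; first by rewrite -ey.
by rewrite -ex -ey.
Qed.

Lemma normalize_core D : premarkov D -> core D (normalize D).
Proof.
rewrite /normalize; move: #|gbox D| => n pD; elim: n => [|n IHn] /=; first exact: core_refl.
apply: core_trans IHn _; set E := iter _ _ _.
have pE : premarkov E.
  by rewrite /E; elim: n {E} => //= n; apply: delete_eliminable_premarkov.
rewrite /delete_eliminable; case: pickP => [b elb|_]; last exact: core_refl.
by apply: delete_core => //; case: pE.
Qed.

Lemma mono_source D (w : gwire D) : left_monogamous D ->
  w \in lleg D \/ exists b : gbox D, w \in gout b.
Proof.
move=> mD; have [wl|wl] := boolP (w \in lleg D); [by left | right].
have := mD w; rewrite (count_memPn wl) add0n => e.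
have [b wb|no] := pickP (fun b : gbox D => w \in gout b); first by exists b.
by move: e; rewrite big1 // => b _; apply/count_memPn; rewrite no.
Qed.

(** By left monogamy every wire is an input of the diagram or an output of a box, so subdiagrams of
    E with the same boxes have the same wires. *)
Lemma embedding_unique A B E (fw : gwire A -> gwire E) (fb : gbox A -> gbox E)
    (gw : gwire B -> gwire E) (gb : gbox B -> gbox E) :
    left_monogamous A -> left_monogamous B ->
    cospan_embedding fw fb -> cospan_embedding gw gb ->
    (forall a, exists b, gb b = fb a) -> (forall b, exists a, fb a = gb b) ->
  cospan_iso A B.
Proof.
move=> mA mB fE gE ab ba.
have wires_in D D' (hw : gwire D -> gwire E) hb (hw' : gwire D' -> gwire E) hb' :
    left_monogamous D -> cospan_embedding hw hb -> cospan_embedding hw' hb' ->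
    (forall b : gbox D, exists b' : gbox D', hb' b' = hb b) ->
  forall w, exists w', hw' w' = hw w.
  move=> mD [_ _ hh _ [hl _]] [_ _ hh' _ [hl' _]] bb w.
  suff /mapP[w' _ ->] : hw w \in map hw' (enum (gwire D')) by exists w'.
  have [wl|[b wb]] := mono_source w mD.
    have : hw w \in lleg E by rewrite hl map_f.
    by rewrite hl' => /mapP[w' _ ->]; rewrite map_f ?mem_enum.
  have [b' eb] := bb b; have [/= _ e] := hh b; have [/= _ e'] := hh' b'.
  have : hw w \in gout (hb b) by rewrite e map_f.
  by rewrite -eb e' => /mapP[w' _ ->]; rewrite map_f ?mem_enum.
have [pw pwE] := fin_all_exists (wires_in _ _ _ _ _ _ mA fE gE ab).
have [qw qwE] := fin_all_exists (wires_in _ _ _ _ _ _ mB gE fE ba).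
have [pb pbE] := fin_all_exists ab.
have [qb qbE] := fin_all_exists ba.
have [fwi fbi fh [fwl fbl] [fll frl]] := fE.
have [gwi gbi gh [gwl gbl] [gll grl]] := gE.
exists pw, pb; split.
- by exists qw => x; [apply: fwi | apply: gwi]; rewrite ?qwE ?pwE ?qwE.
- by exists qb => x; [apply: fbi | apply: gbi]; rewrite ?qbE ?pbE ?qbE.
- move=> b; have [/= f1 f2] := fh b; have [/= g1 g2] := gh (pb b).
  rewrite pbE in g1 g2; split; apply: (inj_map gwi).
    by rewrite /= -g1 f1 -map_comp; apply: eq_map => w /=.
  by rewrite /= -g2 f2 -map_comp; apply: eq_map => w /=.
- by split=> x; [rewrite -gwl pwE fwl | rewrite -gbl pbE fbl].
- split; apply: (inj_map gwi).
    by rewrite -gll fll -map_comp; apply: eq_map => w /=.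
  by rewrite -grl frl -map_comp; apply: eq_map => w /=.
Qed.

Lemma iso_core D E : cospan_iso D E -> core E D.
Proof.
case=> fw [fb [[gw fwK gwK] [gb fbK gbK] fh fl fr]]; exists fw, fb.
have emb : cospan_embedding fw fb by split=> //; [exact: can_inj fwK | exact: can_inj fbK].
split=> // e ne; exists (gb e); first exact: gbK.
exact: embedding_needed (embedding_inv fwK gwK fbK gbK emb) ne.
Qed.

(** All boxes of a normal diagram are needed, so both embeddings have exactly the needed boxes of E
    as image. *)
Lemma core_unique A B E : premarkov A -> premarkov B -> normal A -> normal B ->
  core E A -> core E B -> cospan_iso A B.
Proof.
move=> pA pB nA nB [fw [fb [fE fC]]] [gw [gb [gE gC]]].
apply: (embedding_unique (pm_mono pA) (pm_mono pB) fE gE) => [a|b].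
  by have [b eb _] := gC _ (embedding_needed fE (normal_needed pA nA a)); exists b.
by have [a ea _] := fC _ (embedding_needed gE (normal_needed pB nB b)); exists a.
Qed.

Lemma normalize_iso D E : premarkov D -> premarkov E -> cospan_iso D E ->
  cospan_iso (normalize D) (normalize E).
Proof.
move=> pD pE iDE; apply: (@core_unique _ _ E).
- exact: normalize_premarkov.
- exact: normalize_premarkov.
- exact: normalize_normal.
- exact: normalize_normal.
- exact: core_trans (iso_core iDE) (normalize_core pD).
- exact: normalize_core.
Qed.

Lemma normalize_iso_normal D E : premarkov D -> premarkov E -> normal E ->
  cospan_iso D E -> cospan_iso (normalize D) E.
Proof.
move=> pD pE nE iDE; apply: (@core_unique _ _ E) => //.
- exact: normalize_premarkov.
- exact: normalize_normal.
- exact: core_trans (iso_core iDE) (normalize_core pD).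
- exact: core_refl.
Qed.

End NormalForm.

Lemma inj_surj_bij (T T' : finType) (f : T -> T') :
  injective f -> (forall y, exists x, f x = y) -> bijective f.
Proof.
move=> fi fs; have [g gE] := fin_all_exists fs.
by exists g => // x; apply: fi.
Qed.

(** * Recognizing composites of diagrams *)

Section Composites.
Variable S : signature.
Implicit Types D E T : cospan S.
Implicit Types m n k : seq (wire S).

Definition preserves_labels (G H : lgraph S) (fw : gwire G -> gwire H) (fb : gbox G -> gbox H) :=
  (forall w, wlab (fw w) = wlab w) /\ (forall b, blab (fb b) = blab b).

(** Every class of the pushout contains a wire of D or a wire of E off its left leg, so injectivity
    is only asked on these representatives. *)
Lemma precomp_iso D E T (fD : gwire D -> gwire T) (fE : gwire E -> gwire T)
    (bD : gbox D -> gbox T) (bE : gbox E -> gbox T) :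
    uniq (lleg E) -> map fD (rleg D) = map fE (lleg E) ->
    injective fD -> {in [predC lleg E] &, injective fE} ->
    (forall a v, v \notin lleg E -> fD a <> fE v) ->
    (forall t, (exists a, fD a = t) \/ (exists v, fE v = t)) ->
    bijective (fun b : gbox D + gbox E => match b with inl b => bD b | inr b => bE b end) ->
    @is_hypergraph_hom (hypergraph_of D) (hypergraph_of T) fD bD ->
    @is_hypergraph_hom (hypergraph_of E) (hypergraph_of T) fE bE ->
    preserves_labels fD bD -> preserves_labels fE bE ->
    lleg T = map fD (lleg D) -> rleg T = map fE (rleg E) ->
  cospan_iso (cospan_precomp E D) T.
Proof.
move=> uE eDE fDi fEi fDE surj bbij hD hE [fDl bDl] [fEl bEl] lT rT.
have labE : map wlab (rleg D) = map wlab (lleg E).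
  rewrite -(eq_map fDl) -(eq_map fEl) (map_comp wlab fD) (map_comp wlab fE).
  by rewrite eDE.
have sizeE : size (rleg D) = size (lleg E) by rewrite -(size_map fD) eDE size_map.
pose f (x : gwire D + gwire E) := match x with inl a => fD a | inr v => fE v end.
pose fT (c : gwire (cospan_precomp E D)) := f (val c).
have fTE x : fT (glue (rleg D) (lleg E) x) = f x.
  apply: (glue_inv (F := f)); last by rewrite glue_sym; apply: glue_val.
  by move=> a b; apply: zip_map_eq.
pose good (x : gwire D + gwire E) := match x with inl _ => true | inr v => v \notin lleg E end.
have rep c : exists2 x, good x & c = glue (rleg D) (lleg E) x.
  rewrite -(valK_glue c); case: (val c) => [a|v]; first by exists (inl a).
  have [vE|vE] := boolP (v \in lleg E); last by exists (inr v).
  have: index v (lleg E) < size (rleg D) by rewrite sizeE index_mem.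
  rewrite -onthTE; case ea: (onth _ _) => [a|] // _; exists (inl a) => //.
  by apply/esym/glue_eqP/glue_step; apply: onth_zip ea (onth_index vE).
have fTi : injective fT.
  move=> c c'; have [x gx ->] := rep c; have [y gy ->] := rep c'; rewrite !fTE.
  case: x y gx gy => [a|v] [a'|v'] /= gx gy.
  - by move/fDi ->.
  - by move/fDE; rewrite gy => /(_ isT).
  - by move/esym/fDE; rewrite gx => /(_ isT).
  - by move/fEi ->.
have fTs t : exists c, fT c = t.
  by have [[a <-]|[v <-]] := surj t; [exists (glue _ _ (inl a))|exists (glue _ _ (inr v))];
     rewrite fTE.
exists fT, (fun b : gbox D + gbox E => match b with inl b => bD b | inr b => bE b end).
split=> //.
- exact: inj_surj_bij.
- by case=> b /=; [have [/= -> ->] := hD b | have [/= -> ->] := hE b];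
    rewrite -!map_comp; split; apply: eq_map => w /=; rewrite fTE.
- split; last by case=> b; [exact: bDl|exact: bEl].
  move=> c; have [x _ ->] := rep c; rewrite fTE [RHS](pushout_wlab labE).
  by case: x => [a|v]; [exact: fDl|exact: fEl].
- by rewrite lT rT /= -!map_comp; split; apply: eq_map => w /=; rewrite fTE.
Qed.

Lemma free_comp_iso m n k (g : diagram n k) (f : diagram m n) (d : diagram m k) :
  cospan_iso (cospan_precomp g f) d -> cospan_iso (free_comp g f) d.
Proof.
apply: normalize_iso_normal; [exact: free_comp_pre | exact: dgm_pre | exact: dgm_normal].
Qed.

Lemma map_enum_ord (T : Type) (s : seq T) (p : nat) : size s = p ->
  exists f : 'I_p -> T, map f (enum 'I_p) = s.
Proof. by move=> <-; exists (tnth (in_tuple s)); rewrite map_tnth_enum. Qed.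

Lemma size_rleg m n (f : diagram m n) : size (rleg f) = size n.
Proof. by rewrite -(size_map wlab) dgm_cod. Qed.

(** A wiring only reselects outputs: h names the wire of f at each output position. *)
Lemma comp_wiring_iso m n k (f : diagram m n) (s : seq 'I_(size n))
    (sE : map (tnth (in_tuple n)) s = k) (h : 'I_(size n) -> gwire f) (d : diagram m k) :
    map h (enum 'I_(size n)) = rleg f ->
    dgm d = Cospan (lleg f) (map h s) ->
  cospan_iso (free_comp (free_wiring sE) f) d.
Proof.
move=> hE de; apply: free_comp_iso; rewrite de.
pose T := Cospan (lleg f) (map h s).
apply: (@precomp_iso f (cospan_wiring s) T id h id (fun b => match b with end)) => //=.
- exact: enum_uniq.
- by rewrite map_id hE.
- by move=> x y; rewrite inE mem_enum.
- by move=> a v; rewrite mem_enum.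
- by move=> t; left; exists t.
- by exists inl => [[b|[]]|b].
- by move=> b; rewrite !map_id.
- split; last by case.
  move=> q.
  have := congr1 (map wlab) hE; rewrite dgm_cod -map_comp -[RHS](map_tnth_enum (in_tuple n)).
  by move/eq_in_map => /(_ q (mem_enum _ _)).
- by rewrite map_id.
Qed.

End Composites.

Lemma premarkov_rleg (S : signature) (G : lgraph S) (l r r' : seq (gwire G)) :
  premarkov (Cospan l r) -> premarkov (Cospan l r').
Proof. by case. Qed.

Section Rotation.
Variables (S : signature) (m a b : seq (wire S)) (f : diagram m (a ++ b)).

Definition rot_cospan : cospan S := Cospan (lleg f) (rot (size a) (rleg f)).

Fact rot_cod : map wlab (rleg rot_cospan) = b ++ a.
Proof. by rewrite /= map_rot dgm_cod rot_size_cat. Qed.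

Fact rot_pre : premarkov rot_cospan.
Proof. by apply: (premarkov_rleg (r := rleg f)); case: (f) => -[]. Qed.

Fact rot_normal : normal rot_cospan.
Proof.
move=> c; apply: contra (@dgm_normal _ _ _ f c) => /allP H; apply/allP=> w /H.
by rewrite mem_rot.
Qed.

Definition rot_diagram : diagram m (b ++ a) :=
  @Diagram S m (b ++ a) rot_cospan (dgm_dom f) rot_cod rot_pre rot_normal.

Lemma rot_diagram_iso : cospan_iso (free_comp (free_swap a b) f) rot_diagram.
Proof.
have [h hE] := map_enum_ord (size_rleg f).
by apply: (comp_wiring_iso _ hE); rewrite /= map_rot hE.
Qed.

End Rotation.

(** * Cutting a non-signalling diagram into past and future *)

Section Factorization.
Variables (S : signature) (m n w : seq (wire S)) (f : diagram (m ++ w) (n ++ w)).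
Hypothesis nsf : free_non_signalling f.

Let i := take (size m) (lleg f).
Let i' := drop (size m) (lleg f).
Let j := take (size n) (rleg f).
Let j' := drop (size n) (rleg f).

Let lleg_cat : lleg f = i ++ i'.
Proof. by rewrite cat_take_drop. Qed.
Let rleg_cat : rleg f = j ++ j'.
Proof. by rewrite cat_take_drop. Qed.
Let map_i : map wlab i = m.
Proof. by rewrite map_take dgm_dom take_size_cat. Qed.
Let map_i' : map wlab i' = w.
Proof. by rewrite map_drop dgm_dom drop_size_cat. Qed.
Let map_j : map wlab j = n.
Proof. by rewrite map_take dgm_cod take_size_cat. Qed.
Let map_j' : map wlab j' = w.
Proof. by rewrite map_drop dgm_cod drop_size_cat. Qed.
Let size_i' : size i' = size w.
Proof. by have := congr1 size map_i'; rewrite size_map. Qed.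
Let size_j' : size j' = size w.
Proof. by have := congr1 size map_j'; rewrite size_map. Qed.
Let size_j : size j = size n.
Proof. by have := congr1 size map_j; rewrite size_map. Qed.

Let mono_f : left_monogamous f := pm_mono (dgm_pre f).

Definition past_box : pred (gbox f) := fun b =>
  [exists o, [exists c, [&& o \in gout b, c \in drop (size n) (rleg f) & connect (hstep f) o c]]].

Definition past_wire : pred (gwire f) := fun x =>
  (x \in take (size m) (lleg f)) || [exists b, past_box b && (x \in gout b)].

Lemma past_boxP b c o : o \in gout b -> c \in j' -> connect (hstep f) o c -> past_box b.
Proof. by move=> ob cj oc; apply/existsP; exists o; apply/existsP; exists c; rewrite ob cj. Qed.

Lemma uniq_ii' : uniq (i ++ i').
Proof. by rewrite -lleg_cat; apply: mono_uniq. Qed.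

Lemma i'_not_past x : x \in i' -> ~~ past_wire x.
Proof.
move=> xi; have := uniq_ii'; rewrite cat_uniq => /and3P[_ /hasPn/(_ x xi) xNi _].
rewrite /past_wire negb_or xNi; apply/existsPn => b; rewrite negb_and.
apply/orP; right; apply/negP => xb.
by have := mono_out mono_f xb; rewrite lleg_cat mem_cat xi orbT.
Qed.

(** The use of non-signalling: the source of x is in [i] or is a past box, since a wire of [i']
    cannot reach [j']. *)
Lemma connect_past x c : connect (hstep f) x c -> c \in j' -> past_wire x.
Proof.
move=> xc cj; have [xl|[b xb]] := mono_source x mono_f.
  move: xl; rewrite lleg_cat mem_cat => /orP[xi|xi]; first by rewrite /past_wire xi.
  by have := non_signalling_connect nsf xi cj; rewrite xc.
by apply/orP; right; apply/existsP; exists b; rewrite xb (past_boxP xb cj xc).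
Qed.

Lemma j'_past x : x \in j' -> past_wire x.
Proof. by apply: connect_past; apply: connect0. Qed.

Lemma gin_past b x : past_box b -> x \in gin b -> past_wire x.
Proof.
case/existsP=> o /existsP[c /and3P[ob cj oc]] xb; apply: connect_past cj.
by apply: connect_trans oc; apply: connect1; apply/existsP; exists b; rewrite xb.
Qed.

Lemma gout_past b x : past_box b -> x \in gout b -> past_wire x.
Proof. by move=> pb xb; apply/orP; right; apply/existsP; exists b; rewrite pb. Qed.

(** The single source that f gives to a wire lies in the past exactly when the wire does. Left
    monogamy of both halves follows. *)
Lemma past_mono x :
  count_mem x i + \sum_(b | past_box b) count_mem x (gout b) = past_wire x.
Proof.
have := mono_f x; rewrite lleg_cat count_cat (bigID past_box) /=.
have [px|px] := boolP (past_wire x); last first.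
  move=> _; rewrite (count_memPn _) ?add0n; last by apply: contra px; rewrite /past_wire => ->.
  by rewrite big1 // => b pb; apply/count_memPn; apply: contra px; apply: gout_past.
have -> : count_mem x i' = 0.
  by apply/count_memPn/negP => xi; have := i'_not_past xi; rewrite px.
rewrite addn0 addnA; case e: (\sum_(b | ~~ past_box b) _) => [|k]; first by rewrite addn0.
have [b nb xb] : exists2 b, ~~ past_box b & x \in gout b.
  have [b /andP[nb xb]|no] := pickP (fun b => ~~ past_box b && (x \in gout b)).
    by exists b.
  move: e; rewrite big1 // => b nb; apply/count_memPn.
  by have := no b; rewrite nb /= => ->.
suff : 0 < count_mem x i + \sum_(b | past_box b) count_mem x (gout b).
  by case: (_ + _) => // ? _; rewrite addSn addnS.
case/orP: px => [xi|/existsP[b' /andP[pb' xb']]].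
  by rewrite addn_gt0 -has_count has_pred1 xi.
by rewrite addn_gt0 (bigD1 b') //= addn_gt0 -!has_count !has_pred1 xb' orbT.
Qed.

Let V := {x : gwire f | past_wire x}.
Let restr := pmap (insub : gwire f -> option V).

Definition past_graph : lgraph S :=
  @LGraph S V {b : gbox f | past_box b}
    (fun b => restr (gin (val b))) (fun b => restr (gout (val b)))
    (fun x => wlab (val x)) (fun b => blab (val b)).

(* All the wires of f: those of the past and i' are the inputs.               *)
Definition future_graph : lgraph S :=
  @LGraph S (gwire f) {b : gbox f | ~~ past_box b}
    (fun b => gin (val b)) (fun b => gout (val b)) wlab (fun b => blab (val b)).

Lemma restr_i : map val (restr i) = i.
Proof. by apply: map_val_insub; apply/allP=> x xi; rewrite /past_wire xi. Qed.

Lemma restr_j' : map val (restr j') = j'.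
Proof. by apply: map_val_insub; apply/allP=> x; apply: j'_past. Qed.

Lemma restr_gin (b : gbox past_graph) : map val (gin b) = gin (val b).
Proof. by apply: map_val_insub; apply/allP=> x; apply: gin_past; apply: (valP b). Qed.

Lemma restr_gout (b : gbox past_graph) : map val (gout b) = gout (val b).
Proof. by apply: map_val_insub; apply/allP=> x; apply: gout_past; apply: (valP b). Qed.

(** Passing on every past wire avoids computing which ones the future reads; those it does not read
    are simply discarded inputs. *)
Definition past_types : seq (wire S) := map wlab (enum (gwire past_graph)).

Definition past_cospan : cospan S :=
  @Cospan S past_graph (restr i) (restr j' ++ enum (gwire past_graph)).

Definition future_cospan : cospan S :=
  @Cospan S future_graph (map val (enum (gwire past_graph)) ++ i') j.

Fact past_dom : map wlab (lleg past_cospan) = m.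
Proof. by rewrite -[RHS]map_i -[in RHS]restr_i -map_comp. Qed.

Fact past_cod : map wlab (rleg past_cospan) = w ++ past_types.
Proof.
rewrite map_cat; congr (_ ++ _).
by rewrite -[RHS]map_j' -[in RHS]restr_j' -map_comp.
Qed.

Fact past_pre : premarkov past_cospan.
Proof.
have [ovf af _] := dgm_pre f; split.
- move=> b; have [/= e1 e2] := ovf (val b).
  split; first by rewrite e1 -[in LHS]restr_gin -map_comp.
  by rewrite e2 -[in LHS]restr_gout -map_comp.
- have [r rP] := acyclic_rank af; apply: (@rank_acyclic S past_graph (fun x => r (val x))).
  move=> b x y xb yb; apply: (rP (val b)); first by rewrite -restr_gin map_f.
  by rewrite -restr_gout map_f.
- move=> x; rewrite count_mem_val restr_i -[RHS](_ : past_wire (val x) = 1 :> nat); last first.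
    by rewrite (valP x).
  rewrite -past_mono; congr (_ + _).
  under eq_bigr => c _ do rewrite count_mem_val restr_gout.
  rewrite [RHS](reindex_omap (val : gbox past_graph -> gbox f) insub) /=.
    by apply: eq_bigl => c; rewrite [insub _]valK eqxx andbT; apply/esym/(valP c).
  by move=> c cb; rewrite insubT.
Qed.

(** All past wires are outputs, so an eliminable box would have no output wire and would already be
    eliminable in f. *)
Fact past_normal : normal past_cospan.
Proof.
move=> b; apply: contra (@dgm_normal _ _ _ f (val b)) => /allP H.
rewrite /eliminable -restr_gout; apply/allP=> y /mapP[x xb _].
by have := H x xb; rewrite mem_cat mem_enum orbT.
Qed.

Definition past : diagram m (w ++ past_types) :=
  Diagram past_dom past_cod past_pre past_normal.

Fact future_dom : map wlab (lleg future_cospan) = past_types ++ w.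
Proof. by rewrite map_cat /= map_i' /past_types -map_comp. Qed.

Fact future_pre : premarkov future_cospan.
Proof.
have [ovf af _] := dgm_pre f; split.
- by move=> b; exact: (ovf (val b)).
- have [r rP] := acyclic_rank af; apply: (@rank_acyclic S future_graph r).
  by move=> b x y xb yb; apply: (rP (val b)).
- move=> x; rewrite count_cat.
  have -> : count_mem x (map val (enum (gwire past_graph))) = past_wire x.
    rewrite count_uniq_mem ?(map_inj_uniq val_inj) ?enum_uniq //; congr nat_of_bool.
    by apply/mapP/idP => [[v _ ->]|px]; [exact: (valP v)|exists (Sub x px); rewrite ?mem_enum].
  rewrite -past_mono -[RHS](mono_f x) lleg_cat count_cat [in RHS](bigID past_box) /=.
  rewrite -!addnA; congr (_ + _); rewrite addnCA; congr (_ + (_ + _)).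
  rewrite [RHS](reindex_omap (val : gbox future_graph -> gbox f) insub) /=.
    by apply: eq_bigl => c; rewrite [insub _]valK eqxx andbT; apply/esym/(valP c).
  by move=> c cb; rewrite insubT.
Qed.

(** An output of a future box is neither in [j'] nor read by a past box, since otherwise the box
    itself would be past. *)
Fact future_normal : normal future_cospan.
Proof.
move=> b; apply: contra (@dgm_normal _ _ _ f (val b)) => /allP H.
apply/allP=> x xb; have /andP[xj /forallP xi] := H x xb.
have nb : ~~ past_box (val b) := valP b.
rewrite rleg_cat mem_cat negb_or xj /=; apply/andP; split.
  by apply: contra nb => xj'; apply: past_boxP xb xj' (connect0 _ _).
apply/forallP=> c; have [|nc] := boolP (past_box c); last exact: (xi (Sub c nc)).
case/existsP=> o /existsP[d /and3P[oc dj od]]; apply: contra nb => xc.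
apply: past_boxP xb dj (connect_trans (connect1 _) od).
by apply/existsP; exists c; rewrite xc.
Qed.

Definition future : diagram (past_types ++ w) n :=
  Diagram future_dom map_j future_pre future_normal.

Fact strand_cod :
  map wlab (rleg (cospan_tensor past (free_id w))) = w ++ (past_types ++ w).
Proof. by rewrite [RHS]catA; exact: dgm_cod (free_tensor past (free_id w)). Qed.

(* free_tensor past (free_id w) with reassociated codomain                    *)
Definition past_strand : diagram (m ++ w) (w ++ (past_types ++ w)) :=
  let d := free_tensor past (free_id w) in
  @Diagram S _ _ d (dgm_dom d) strand_cod (dgm_pre d) (@dgm_normal _ _ _ d).

Lemma past_strand_iso :
  cospan_iso (free_comp (free_cast (esym (catA w past_types w)))
                        (free_tensor past (free_id w))) past_strand.
Proof.
have [h hE] := map_enum_ord (size_rleg (free_tensor past (free_id w))).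
by apply: (comp_wiring_iso _ hE); rewrite hE.
Qed.

Lemma factor_iso :
  cospan_iso (free_comp (free_tensor (free_id w) future) past_strand) (rot_diagram f).
Proof.
apply: free_comp_iso.
have [hi hiE] := map_enum_ord size_i'.
have [hj hjE] := map_enum_ord size_j'.
pose T : cospan S := rot_diagram f.
(* The identity strand beside the past is the second input [i']; the one beside the future is the
   second output [j']. *)
pose fD (x : V + 'I_(size w)) : gwire f := match x with inl v => val v | inr q => hi q end.
pose fE (x : 'I_(size w) + gwire f) : gwire f := match x with inl q => hj q | inr x => x end.
pose bD (b : {b : gbox f | past_box b} + void) : gbox f :=
  match b with inl b => val b | inr b => match b with end end.
pose bE (b : void + {b : gbox f | ~~ past_box b}) : gbox f :=
  match b with inl b => match b with end | inr b => val b end.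
have hi_i q : hi q \in i' by rewrite -hiE map_f ?mem_enum.
have fD_cat s t : map fD (map inl s ++ map inr t) = map val s ++ map hi t.
  by rewrite map_cat -!map_comp.
have fE_cat s t : map fE (map inl s ++ map inr t) = map hj s ++ t.
  by rewrite map_cat -!map_comp map_id.
have hi_past q : ~~ past_wire (hi q) by apply: i'_not_past.
have hi_inj : injective hi.
  have := uniq_ii'; rewrite cat_uniq -hiE => /and3P[_ _ /injectiveP]; exact.
have lE x : x \in lleg (cospan_tensor (free_id w) future) =
    match x with inl _ => true | inr x => past_wire x || (x \in i') end.
  rewrite mem_cat; case: x => [q|x].
    by rewrite map_f // mem_enum.
  rewrite [X in X || _](_ : _ = false) /=; last by apply/mapP=> -[].
  rewrite (mem_map (@inr_inj _ _)) mem_cat; congr (_ || _).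
  by apply/mapP/idP => [[v _ ->]|px]; [exact: (valP v)|exists (Sub x px); rewrite ?mem_enum].
apply: (@precomp_iso S past_strand (cospan_tensor (free_id w) future) T fD fE bD bE).
- apply: mono_uniq; exact: pm_mono (dgm_pre (free_tensor (free_id w) future)).
- by rewrite fD_cat fE_cat map_cat restr_j' hiE hjE catA.
- case=> [v|q] [v'|q'] /=.
  + by move/val_inj->.
  + by move=> e; have := hi_past q'; rewrite -e (valP v).
  + by move=> e; have := hi_past q; rewrite e (valP v').
  + by move/hi_inj->.
- by case=> [q|x] [q'|x']; rewrite !inE !lE //= => _ _ ->.
- move=> a [q|x]; rewrite lE // negb_or => /andP[px xi].
  case: a => [v|q] /= e; first by rewrite -e (valP v) in px.
  by rewrite -e hi_i in xi.
- by move=> t; right; exists (inr t).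
- apply: inj_surj_bij => [b c|b].
    case: b c => [[b|[]]|[[]|b]] [[c|[]]|[[]|c]] /= e.
    + by congr (inl (inl _)); apply: val_inj.
    + by have := valP c; rewrite /= -e (valP b).
    + by have := valP b; rewrite /= e (valP c).
    + by congr (inr (inr _)); apply: val_inj.
  by have [pb|nb] := boolP (past_box b); [exists (inl (inl (Sub b pb)))|exists (inr (inr (Sub b nb)))].
- case=> [b|[]]; split; rewrite /= -map_comp; first exact/esym/restr_gin.
  exact/esym/restr_gout.
- by case=> [[]|b]; rewrite /= -!map_comp !map_id.
- split; last by case.
  case=> [v|q] //=.
  have := congr1 (map wlab) hiE; rewrite map_i' -map_comp -[RHS](map_tnth_enum (in_tuple w)).
  by move/eq_in_map => /(_ q (mem_enum _ _)).
- split; last by case.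
  case=> [q|v] //=.
  have := congr1 (map wlab) hjE; rewrite map_j' -map_comp -[RHS](map_tnth_enum (in_tuple w)).
  by move/eq_in_map => /(_ q (mem_enum _ _)).
- by rewrite fD_cat restr_i hiE -lleg_cat.
- by rewrite fE_cat hjE /= rleg_cat -size_j rot_size_cat.
Qed.

(** Both sides normalize a pushout, and the pushouts are already isomorphic. *)
Lemma contr_iso :
  cospan_iso (free_comp future (rot_diagram past)) (free_contr nsf).
Proof.
apply: normalize_iso; [exact: free_comp_pre | exact: free_contr_pre nsf |].
have [hi hiE] := map_enum_ord size_i'.
have [hj hjE] := map_enum_ord size_j'.
have hi_past q : ~~ past_wire (hi q) by apply: i'_not_past; rewrite -hiE map_f ?mem_enum.
have hj_past q : past_wire (hj q) by apply: j'_past; rewrite -hjE map_f ?mem_enum.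
have hi_inj : injective hi.
  have := uniq_ii'; rewrite cat_uniq -hiE => /and3P[_ _ /injectiveP]; exact.
pose s := i' ++ j'; pose t := wires w ++ wires w.
have zipE x q : ((x, q) \in zip s t) = (x == hi q) || (x == hj q).
  rewrite zip_cat ?size_i' ?size_enum_ord // mem_cat /wires -hiE -hjE.
  suff H (g : 'I_(size w) -> gwire f) : ((x, q) \in zip (map g (enum 'I_(size w))) (enum 'I_(size w)))
      = (x == g q) by rewrite !H.
  have -> l : zip (map g l) l = map (fun q => (g q, q)) l by elim: l => //= ? ? ->.
  by apply/mapP/eqP => [[q' _ [-> ->]]|->]; last by exists q; rewrite ?mem_enum.
(* A representative for each class of the contraction: wires of [i'] move to the matching wires of
   [j']. It is constant on classes because [j'] is past and hence disjoint from [i']. *)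
pose r x := if [pick q | hi q == x] is Some q then hj q else x.
have r_hi q : r (hi q) = hj q.
  by rewrite /r; case: pickP => [q' /eqP/hi_inj-> //|/(_ q)]; rewrite eqxx.
have r_id x : x \notin i' -> r x = x.
  by rewrite /r; case: pickP => // q /eqP<-; rewrite -hiE map_f // mem_enum.
have past_notin_i' x : past_wire x -> x \notin i'.
  by apply: contraL; apply: i'_not_past.
have glue_r x y : glue s t (inl x) = glue s t (inl y) -> r x = r y.
  pose F (z : gwire f + 'I_(size w)) := match z with inl z => r z | inr q => hj q end.
  move/glue_eqP; apply: (glue_inv (F := F)) => a q; rewrite zipE => /orP[]/eqP-> //=.
  by rewrite r_id // past_notin_i'.
pose T := cospan_precontr (size m) (size n) w f.
pose fE (x : gwire f) : gwire T := glue s t (inl x).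
pose fD (v : V) : gwire T := fE (val v).
pose bD (b : {b : gbox f | past_box b}) : gbox T := inl (val b).
pose bE (b : {b : gbox f | ~~ past_box b}) : gbox T := inl (val b).
have fE_hi q : fE (hi q) = glue s t (inr q).
  by apply/glue_eqP/glue_step; rewrite zipE eqxx.
have fE_hj q : fE (hj q) = glue s t (inr q).
  by apply/glue_eqP/glue_step; rewrite zipE eqxx orbT.
have lE x : (x \in lleg future) = past_wire x || (x \in i').
  rewrite mem_cat; congr (_ || _).
  by apply/mapP/idP => [[v _ ->]|px]; [exact: (valP v)|exists (Sub x px); rewrite ?mem_enum].
have labE : map wlab s = map (@wlab S (discrete w)) t.
  by rewrite !map_cat map_i' map_j' map_wires.
apply: (@precomp_iso S (rot_diagram past) future T fD fE bD bE).
- exact: mono_uniq (pm_mono future_pre).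
(* The right leg of the rotated past ends in [j'] where the left leg of the future ends in [i'], so
   composing makes the identifications of the contraction. *)
- have sj : size (restr j') = size w by rewrite -size_j' -{2}restr_j' size_map.
  have rotE : rot (size w) (restr j' ++ enum (gwire past_graph)) = enum (gwire past_graph) ++ restr j'.
    by rewrite -{1}sj rot_size_cat.
  rewrite /= rotE !map_cat -map_comp; congr (_ ++ _).
  rewrite (map_comp fE val) restr_j' -hiE -hjE -!map_comp.
  by apply: eq_map => q /=; rewrite fE_hi fE_hj.
- move=> v v' /glue_r; rewrite !r_id ?past_notin_i' ?(valP v) ?(valP v') //; exact: val_inj.
- move=> x y; rewrite !inE !lE !negb_or => /andP[_ xi] /andP[_ yi] /glue_r.
  by rewrite !r_id.
- move=> v x; rewrite lE negb_or => /andP[px xi] /glue_r.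
  rewrite (r_id x) // r_id ?past_notin_i' ?(valP v) // => e.
  by rewrite -e (valP v) in px.
- move=> c; right; rewrite -(valK_glue c); case: (val c) => [x|q]; first by exists x.
  by exists (hi q).
- apply: inj_surj_bij => [[b|b] [c|c] [] e|[b|[]]].
  + by congr inl; apply: val_inj.
  + by have := valP c; rewrite /= -e (valP b).
  + by have := valP b; rewrite /= e (valP c).
  + by congr inr; apply: val_inj.
  + by have [pb|nb] := boolP (past_box b); [exists (inl (Sub b pb))|exists (inr (Sub b nb))].
- move=> b; have fDE l : map fE (map val l) = map fD l by rewrite -map_comp.
  by split; rewrite /= -fDE; congr (map fE _); [exact/esym/restr_gin|exact/esym/restr_gout].
- by [].
- by split=> // v; apply: (pushout_wlab labE).
- by split=> // v; apply: (pushout_wlab labE).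
- by rewrite /= -/i -[in LHS]restr_i -map_comp.
- by [].
Qed.

End Factorization.

(** * Interpreting the factorization in C *)

Section Interpretation.
Variables (S : signature) (C : markov) (F : markov_functor S C).

Lemma muK m n : mu F m n ∘ muV F m n = idm _.
Proof. by case: (mu_iso F m n). Qed.

Variables (m n w : seq (wire S)) (f : diagram (m ++ w) (n ++ w)).
Hypothesis nsf : free_non_signalling f.

Let z := past_types f.
Let h := muV F w z ∘ imap F (past nsf).
Let k := imap F (future f) ∘ mu F z w.

(** Up to the invertible [mu], f with its second output moved to the front has the form that
    [contract_plug] expects; [mu_assoc] absorbs the reassociation. *)
Lemma imap_factor :
  mu F w n ∘ ((idm (iob F w) ⊠ k) ∘ assoc _ _ _ ∘ (h ⊠ idm (iob F w)))
  = imap F (free_swap n w) ∘ imap F f ∘ mu F m w.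
Proof.
rewrite -imap_comp (imap_iso F (rot_diagram_iso f)) -(imap_iso F (factor_iso nsf)).
rewrite imap_comp -(imap_iso F (past_strand_iso nsf)) imap_comp -!compA mu_nat.
have -> : imap F (past nsf) = mu F w z ∘ h by rewrite compA muK comp1m.
rewrite imap_id (tens_compl _ (mu F w z) h) (compA (mu F (w ++ z) w)) (compA (imap F (free_cast _))).
rewrite (compA (imap F (free_cast _)) (mu F _ _)) mu_assoc -!compA.
rewrite (compA (imap F (free_tensor _ _))) mu_nat imap_id.
by rewrite /k tens_compr -!compA.
Qed.

Lemma imap_contr : imap F (free_contr nsf) = k ∘ swap _ _ ∘ h.
Proof.
rewrite -(imap_iso F (contr_iso nsf)) imap_comp -(imap_iso F (rot_diagram_iso _)).
rewrite imap_comp -[imap F (past nsf)]comp1m -muK -compA -/h.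
by rewrite (compA (imap F (free_swap _ _))) mu_swap !compA.
Qed.

End Interpretation.

Theorem corollary32 (C : markov) :
  cancellative C -> atomic C -> has_conditionals C ->
  satisfies_contraction_identities C.
Proof.
move=> canc atom cond S m n w f1 f2 ns1 ns2 F e.
rewrite !imap_contr; apply: contract_plug => //.
apply: (iso_monic (mu_iso F w n)).
by rewrite !imap_factor e.
Qed.
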